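(* For any integer $n\ge 0$, we have \[\mathrm{pod}_{-3}(11n+10)\equiv 4(-1)^{n}r_7(8n+7) \pmod{11}.\]
   Context: $\mathrm{pod}_{-3}(n)$ denotes the number of partition triples of $n$ in which the odd parts in each of the three partitions are distinct. Equivalently, as formal power series, \[\sum_{n=0}^{\infty}\mathrm{pod}_{-3}(n)q^n=\frac{(-q;q^2)_\infty^3}{(q^2;q^2)_\infty^3}=\frac{1}{\psi(-q)^3},\] where $\psi(q)=\sum_{n=0}^{\infty}q^{n(n+1)/2}$ and $(a;q)_\infty=\prod_{k\ge 0}(1-aq^k)$. $r_k(n)$ denotes the number of representations of $n$ as a sum of $k$ squares, i.e. the number of $(x_1,\dots,x_k)\in\mathbb{Z}^k$ with $x_1^2+\cdots+x_k^2=n$. *)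

(* Defs.v *)
From mathcomp Require Import all_boot all_order all_algebra.

Set Implicit Arguments.
Unset Strict Implicit.
Unset Printing Implicit Defensive.

Import GRing.Theory.

Definition is_partition (s : seq nat) : bool :=
  sorted geq s && all (leq 1) s.

Definition odd_parts_distinct (s : seq nat) : bool :=
  uniq [seq p <- s | odd p].

(* A partition of some m <= n has at most n parts, each at most n, so that it is
   a sequence of length at most n with entries in {0, ..., n}: ranging over
   {bseq n of 'I_n.+1} omits none. *)
Definition pod_tuples (k n : nat) : {set {ffun 'I_k -> {bseq n of 'I_n.+1}}} :=
  [set l : {ffun 'I_k -> {bseq n of 'I_n.+1}} |
     [forall j, is_partition (map val (l j))
                  && odd_parts_distinct (map val (l j))]
     && (\sum_(j < k) sumn (map val (l j)) == n)].

(* pod_neg k n is the number pod_{-k}(n). *)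
Definition pod_neg (k n : nat) : nat := #|pod_tuples k n|.

(* If x_1^2 + ... + x_k^2 = n then |x_i| <= x_i^2 <= n for all i, so that x_i is
   y - n for a unique y in {0, ..., 2n}. *)
Definition shifted_int (n : nat) (y : 'I_(n.*2).+1) : int :=
  (Posz y - Posz n)%R.

Definition sum_squares_reps (k n : nat) : {set {ffun 'I_k -> 'I_(n.*2).+1}} :=
  [set y : {ffun 'I_k -> 'I_(n.*2).+1} |
     (\sum_(i < k) shifted_int (y i) ^+ 2 == Posz n)%R].

Definition num_sum_squares (k n : nat) : nat := #|sum_squares_reps k n|.

(* Main.v *)
Require Import Defs.
From mathcomp Require Import all_boot all_order all_algebra finfield.
From mathcomp Require Import zify ring.

(* Modulo 11, pod_{-3} has generating function
   [1 / psi(-q)^3 = psi(-q)^8 / psi(-q)^11 = psi(-q)^8 / psi(-q^11)].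
   The coefficient of q^n in psi(q)^8 is [f(n+1)], where f(m) is the sum of d^3 over
   the divisors d of m with m/d odd, and [f(11m) = f(m)] modulo 11. Extracting
   the exponents 11n + 10 thus gives [psi(-q)^8 / psi(-q) = psi(-q)^7], while
   [r_7(8n+7) = 2368 t_7(n)], t_7(n) being the coefficient of q^n in psi(q)^7, and
   [4 * 2368 = 1] modulo 11.
   The formula for psi^8 rests on [psi^4 = sum sigma(2n+1) q^n], which is checked on
   logarithmic derivatives: that of psi follows from Gauss's product formula, and
   that of the divisor series is a convolution identity of Liouville type, as is
   the squaring step from psi^4 to psi^8.
   Power series are polynomials taken modulo 'X^N. *)

Set Implicit Arguments.
Unset Strict Implicit.
Unset Printing Implicit Defensive.
Import Order.TTheory GRing.Theory Num.Theory.
Local Open Scope ring_scope.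

(** * Truncated power series and the Gauss product for psi *)

(** The prime 11 matters because [11 - 3 = 8] is an exponent at which the power of psi is a pure
    divisor sum. Since divisors divisible by 11 drop out of that sum modulo 11, the exponents
    [11n + 10] of psi(-q)^8 reproduce psi(-q)^8 itself up to renumbering, while psi(-q^11) becomes
    psi(-q); one factor then cancels. In place of modular forms, psi^4 is identified by a
    recurrence: a series with constant term 1 is determined by its logarithmic derivative. That
    [sigma (2n+1)] obeys the same recurrence is an identity between sums over the solutions of
    [a x + b y = m], which Euclidean steps permute. Passing through psi^4 lets a single quadratic
    Liouville identity serve both for this recurrence and for the squaring. *)

Lemma sum_seq_bij (R : nmodType) (S T : eqType) (s : seq S) (t : seq T)
    (P : pred S) (Q : pred T) (h : S -> T) (g : T -> S) (F : T -> R) :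
  uniq s -> uniq t ->
  (forall x, x \in s -> P x -> [/\ h x \in t, Q (h x) & g (h x) = x]) ->
  (forall y, y \in t -> Q y -> [/\ g y \in s, P (g y) & h (g y) = y]) ->
  \sum_(x <- s | P x) F (h x) = \sum_(y <- t | Q y) F y.
Proof.
move=> us ut hP gQ; rewrite -big_filter -[RHS]big_filter.
rewrite -(big_map h predT F) /=; apply: perm_big; apply: uniq_perm.
- rewrite map_inj_in_uniq ?filter_uniq // => x y.
  rewrite !mem_filter => /andP[Px xs] /andP[Py ys] e.
  have [_ _ <-] := hP x xs Px; have [_ _ <-] := hP y ys Py; by rewrite e.
- exact: filter_uniq.
move=> y; apply/mapP/idP => [[x]|].
  by rewrite !mem_filter => /andP[Px xs] ->; have [-> -> _] := hP x xs Px.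
rewrite mem_filter => /andP[Qy yt]; have [gs Pg e] := gQ y yt Qy.
by exists (g y) => //; rewrite mem_filter Pg gs.
Qed.

Lemma sum_seq_dep_bij (R : nmodType) (S T U : eqType) (s : seq S) (t : seq T)
    (u : T -> seq U) (P : pred S) (Q : pred T) (V : T -> pred U)
    (h : S -> T) (k : S -> U) (g : T -> U -> S) (F : T -> U -> R) :
  uniq s -> uniq t -> (forall y, uniq (u y)) ->
  (forall x, x \in s -> P x ->
     [/\ h x \in t, Q (h x), k x \in u (h x), V (h x) (k x) & g (h x) (k x) = x]) ->
  (forall y z, y \in t -> Q y -> z \in u y -> V y z ->
     [/\ g y z \in s, P (g y z), h (g y z) = y & k (g y z) = z]) ->
  \sum_(x <- s | P x) F (h x) (k x) = \sum_(y <- t | Q y) \sum_(z <- u y | V y z) F y z.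
Proof.
move=> us ut uu hP gQ.
rewrite -[RHS]big_filter.
under [RHS]eq_bigr => y _ do rewrite -big_filter.
rewrite -(big_allpairs_dep (h := pair) (r1 := filter Q t) (r2 := fun y => filter (V y) (u y))
  (F := fun w => F w.1 w.2)).
apply: (@sum_seq_bij _ _ _ _ _ _ predT (fun x => (h x, k x)) (fun w => g w.1 w.2)
  (fun w => F w.1 w.2)) => //.
- apply: allpairs_uniq_dep; first exact: filter_uniq.
    by move=> y _; exact: filter_uniq.
  by move=> [y z] [y' z'] _ _ [-> ->].
- move=> x xs Px; have [ht Qh ku Vk e] := hP x xs Px; split=> //.
  by apply: allpairs_f_dep; rewrite mem_filter ?Qh ?Vk.
- move=> w /allpairsPdep[y [z [+ + ->]]] _; rewrite !mem_filter => /andP[Qy yt] /andP[Vz zu].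
  by have [gs Pg /= -> ->] := gQ y z yt Qy zu Vz.
Qed.

Section Truncation.
Variable R : comNzRingType.
Implicit Types p q r : {poly R}.

Definition eq_upto N p q := forall i, (i < N)%N -> p`_i = q`_i.

Lemma eq_uptoW N p q : p = q -> eq_upto N p q. Proof. by move=> ->. Qed.

Lemma eq_upto_sym N p q : eq_upto N p q -> eq_upto N q p.
Proof. by move=> e i lt_iN; rewrite e. Qed.

Lemma eq_upto_trans N p q r : eq_upto N p q -> eq_upto N q r -> eq_upto N p r.
Proof. by move=> e1 e2 i lt_iN; rewrite e1 // e2. Qed.

Lemma eq_upto_le M N p q : (M <= N)%N -> eq_upto N p q -> eq_upto M p q.
Proof. by move=> le e i lt_iM; apply: e; apply: leq_trans lt_iM le. Qed.

Lemma eq_uptoD N p p' q q' :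
  eq_upto N p p' -> eq_upto N q q' -> eq_upto N (p + q) (p' + q').
Proof. by move=> e1 e2 i lt_iN; rewrite !coefD e1 // e2. Qed.

Lemma eq_uptoN N p p' : eq_upto N p p' -> eq_upto N (- p) (- p').
Proof. by move=> e i lt_iN; rewrite !coefN e. Qed.

Lemma eq_uptoM N p p' q q' :
  eq_upto N p p' -> eq_upto N q q' -> eq_upto N (p * q) (p' * q').
Proof.
move=> e1 e2 i lt_iN; rewrite !coefM; apply: eq_bigr => j _.
have := ltn_ord j => ?; rewrite e1 ?e2 //; lia.
Qed.

Lemma eq_uptoMl N p q q' : eq_upto N q q' -> eq_upto N (p * q) (p * q').
Proof. exact: eq_uptoM. Qed.

Lemma eq_uptoMr N p q q' : eq_upto N q q' -> eq_upto N (q * p) (q' * p).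
Proof. by move=> ?; apply: eq_uptoM. Qed.

Lemma eq_uptoX N p p' k : eq_upto N p p' -> eq_upto N (p ^+ k) (p' ^+ k).
Proof. by move=> e; elim: k => // k IH; rewrite !exprS; apply: eq_uptoM. Qed.

Lemma eq_upto_prod N I (r : seq I) (P : pred I) (F G : I -> {poly R}) :
  (forall i, P i -> eq_upto N (F i) (G i)) ->
  eq_upto N (\prod_(i <- r | P i) F i) (\prod_(i <- r | P i) G i).
Proof. by move=> e; apply: (big_ind2 (eq_upto N)) => // *; apply: eq_uptoM. Qed.

Lemma eq_upto_Xn0 N m : (N <= m)%N -> eq_upto N ('X^m : {poly R}) 0.
Proof. by move=> le i lt_iN; rewrite coefXn coef0; case: eqP => // ?; lia. Qed.

(** Replaces division of power series: a factor with constant term 1 determines the coefficients of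
    its cofactor one after the other. *)
Lemma eq_upto_cancel N p q r :
  r`_0 = 1 -> eq_upto N (p * r) (q * r) -> eq_upto N p q.
Proof.
move=> r0 e i; elim/ltn_ind: i => i IH lt_iN.
have := e i lt_iN; rewrite !coefM !big_ord_recr /= subnn r0 !mulr1.
suff -> : \sum_(j < i) p`_j * r`_(i - j) = \sum_(j < i) q`_j * r`_(i - j).
  exact: addrI.
by apply: eq_bigr => j _; rewrite IH //; have := ltn_ord j; lia.
Qed.

(** The Euler operator q d/dq; unlike the plain derivative it keeps the order of truncation. *)
Definition theta p := 'X * p^`().

Lemma coef_theta p i : (theta p)`_i = p`_i *+ i.
Proof. by rewrite /theta coefXM; case: i => // i; rewrite coef_deriv. Qed.

Lemma eq_upto_theta N p q : eq_upto N p q -> eq_upto N (theta p) (theta q).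
Proof. by move=> e i lt_iN; rewrite !coef_theta e. Qed.

Lemma thetaM p q : theta (p * q) = theta p * q + p * theta q.
Proof. by rewrite /theta derivM; ring. Qed.

Lemma theta_exp p k : theta (p ^+ k.+1) = (theta p * p ^+ k) *+ k.+1.
Proof. by rewrite /theta deriv_exp mulrnAr mulrA. Qed.

End Truncation.

Definition triangle k : nat := (k * k.+1)./2.

Lemma double_triangle k : ((triangle k).*2 = k * k.+1)%N.
Proof. by rewrite /triangle; have := odd_double_half (k * k.+1); rewrite oddM /=; case: (odd k). Qed.

Definition psi N : {poly int} := \sum_(k < N) 'X^(triangle k).

Definition prod_odd (n : nat) : {poly int} := \prod_(1 <= i < n.+1) (1 - 'X^(i.*2.-1)).
(** For [m <= n] this is the quotient of (q^2; q^2)_n by (q^2; q^2)_m, written so that no division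
    occurs in Shanks's sum. *)
Definition prod_even (m n : nat) : {poly int} := \prod_(m.+1 <= i < n.+1) (1 - 'X^(i.*2)).

(* Shanks, "Two theorems of Gauss": a finite form of
   [psi(q) (q; q^2) = (q^2; q^2)], all terms with [s > 0] being negligible. *)
Lemma shanks (n : nat) :
  \sum_(s < n.+1) prod_even s n * prod_odd s * 'X^(s * n.*2.+1)
  = prod_odd n * psi n.*2.+1.
Proof.
elim: n => [|n IH].
  by rewrite big_ord1 /psi big_ord1 /prod_even /prod_odd !big_geq // mulr1.
have oddS s : prod_odd s.+1 = prod_odd s * (1 - 'X^(s.*2.+1)).
  by rewrite /prod_odd big_nat_recr.
have evenS s : (s <= n)%N -> prod_even s n.+1 = prod_even s n * (1 - 'X^(n.+1.*2)).
  by move=> le_sn; rewrite /prod_even big_nat_recr.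
have evenSl s : (s < n)%N -> prod_even s n = (1 - 'X^(s.+1.*2)) * prod_even s.+1 n.
  by move=> lt_sn; rewrite /prod_even big_ltn.
have psiSS : psi n.+1.*2.+1 = psi n.*2.+1 + 'X^(n.+1 * n.*2.+1) + 'X^(n.+1 * n.*2.+3).
  rewrite /psi doubleS !(big_ord_recr n.*2.+2) /= (big_ord_recr n.*2.+1) /=.
  congr (_ + 'X^_ + 'X^_).
    by have := double_triangle n.*2.+1; lia.
  by have := double_triangle n.*2.+2; lia.
(* At [k = n] the boundary term supplies the summand of psi with exponent [(n+1)(2n+1)]; the summand
   [s = n+1], split off afterwards, supplies the one with exponent [(n+1)(2n+3)]. *)
have tele k : (k <= n)%N ->
  \sum_(s < k.+1) prod_even s n.+1 * prod_odd s * 'X^(s * n.*2.+3)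
  = (1 - 'X^(n.*2.+1)) * \sum_(s < k.+1) prod_even s n * prod_odd s * 'X^(s * n.*2.+1)
    + prod_even k n * prod_odd k.+1 * 'X^(k.+1 * n.*2.+1).
  elim: k => [_|k IHk lt_kn].
    rewrite !big_ord1 /= !mul0n !mul1n expr0 oddS evenS //= /prod_odd big_geq //.
    by rewrite doubleS !exprS; ring.
  rewrite big_ord_recr /= IHk; last by lia.
  rewrite [in RHS]big_ord_recr /= mulrDr -!addrA; congr (_ + _).
  rewrite evenS // (evenSl k) // (oddS k.+1).
  rewrite (_ : k.+1 * n.*2.+3 = k.+1 * n.*2.+1 + k.+1.*2)%N; last by lia.
  rewrite (_ : k.+2 * n.*2.+1 = k.+1 * n.*2.+1 + n.*2.+1)%N; last by lia.
  rewrite (_ : n.+1.*2 = n.*2.+1 + 1)%N; last by lia.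
  rewrite (_ : k.+1.*2.+1 = k.+1.*2 + 1)%N; last by lia.
  by rewrite !exprD expr1; ring.
rewrite big_ord_recr /= doubleS tele // IH -doubleS psiSS oddS.
have -> : prod_even n n = 1 by rewrite /prod_even big_geq.
have -> : prod_even n.+1 n.+1 = 1 by rewrite /prod_even big_geq.
by rewrite doubleS; ring.
Qed.

Lemma gauss_psi n :
  eq_upto n.*2.+1 (prod_even 0 n) (prod_odd n * psi n.*2.+1).
Proof.
rewrite -shanks big_ord_recl /= mul0n expr0 /prod_odd big_geq // !mulr1.
rewrite -[X in eq_upto _ X]addr0; apply: eq_uptoD => //.
move=> i lt_i; rewrite coef0 coef_sum big1 // => s _.
rewrite coefMXn /bump; case: ltnP => // le; exfalso; nia.
Qed.

(** * Sums over the solutions of [a x + b y = n] *)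

(** Factorisations of [n]: a divisor and its cofactor. The list is empty for [n = 0], so that
    divisor sums vanish there. *)
Definition pairs (n : nat) : seq (nat * nat) :=
  [seq p <- [seq (a, x) | a <- iota 1 n, x <- iota 1 n] | (p.1 * p.2 == n)%N].

Lemma uniq_pairs n : uniq (pairs n).
Proof. by apply/filter_uniq/allpairs_uniq; rewrite ?iota_uniq // => -[? ?] [? ?]. Qed.

Lemma mem_pairs n p : (p \in pairs n) = (0 < n)%N && (p.1 * p.2 == n)%N.
Proof.
case: p => a x; rewrite mem_filter /= andbC.
have -> : ((a, x) \in [seq (a, x) | a <- iota 1 n, x <- iota 1 n])
          = (0 < a <= n)%N && (0 < x <= n)%N.
  apply/allpairsP/idP => [[[a' x'] [/= + + [-> ->]]]|/andP[ha hx]].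
    by rewrite !mem_iota => h1 h2; lia.
  by exists (a, x); split; rewrite //= mem_iota; lia.
case: eqP => [/= <-|_]; rewrite ?andbF ?andbT //.
case: a x => [|a] [|x]; rewrite ?muln0 //.
by have := leq_pmulr a.+1 (ltn0Sn x); have := leq_pmull x.+1 (ltn0Sn a); lia.
Qed.

Definition quads (n : nat) : seq ((nat * nat) * (nat * nat)) :=
  [seq v <- [seq (p, r) | p <- [seq (a, x) | a <- iota 1 n, x <- iota 1 n],
                          r <- [seq (a, x) | a <- iota 1 n, x <- iota 1 n]]
     | (v.1.1 * v.1.2 + v.2.1 * v.2.2 == n)%N].

Definition is_quad n a x b y : bool :=
  [&& 0 < a, 0 < x, 0 < b, 0 < y & a * x + b * y == n]%N.

Lemma uniq_quads n : uniq (quads n).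
Proof.
apply/filter_uniq/allpairs_uniq; last by move=> [? ?] [? ?].
- by apply/allpairs_uniq; rewrite ?iota_uniq // => -[? ?] [? ?].
- by apply/allpairs_uniq; rewrite ?iota_uniq // => -[? ?] [? ?].
Qed.

Lemma mem_quads n v : (v \in quads n) = is_quad n v.1.1 v.1.2 v.2.1 v.2.2.
Proof.
case: v => [[a x] [b y]]; rewrite mem_filter /= /is_quad andbC.
have memp a' x' : ((a', x') \in [seq (a, x) | a <- iota 1 n, x <- iota 1 n])
          = (0 < a' <= n)%N && (0 < x' <= n)%N.
  apply/allpairsP/idP => [[[a0 x0] [/= + + [-> ->]]]|/andP[ha hx]].
    by rewrite !mem_iota => h1 h2; lia.
  by exists (a', x'); split; rewrite //= mem_iota; lia.
have -> : (((a, x), (b, y)) \in [seq (p, r) | p <- [seq (a, x) | a <- iota 1 n, x <- iota 1 n],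
                          r <- [seq (a, x) | a <- iota 1 n, x <- iota 1 n]])
  = [&& 0 < a <= n, 0 < x <= n, 0 < b <= n & 0 < y <= n]%N.
  apply/allpairsP/idP => [[[p r] [/= hp hr e]]|].
    by case: e hp hr => <- <-; rewrite !memp => /andP[-> ->] /andP[-> ->].
  by move=> /and4P[h1 h2 h3 h4]; exists ((a, x), (b, y)); split; rewrite // memp ?h1 ?h2 ?h3 ?h4.
case: eqP => [/= <-|_]; rewrite ?andbF ?andbT //.
case: a x b y => [|a] [|x] [|b] [|y]; rewrite ?muln0 ?andbF //=.
have := leq_pmulr a.+1 (ltn0Sn x); have := leq_pmull x.+1 (ltn0Sn a).
by have := leq_pmulr b.+1 (ltn0Sn y); have := leq_pmull y.+1 (ltn0Sn b); lia.
Qed.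

Definition qsum n (P : nat -> nat -> nat -> nat -> bool)
    (W : nat -> nat -> nat -> nat -> int) : int :=
  \sum_(v <- quads n | P v.1.1 v.1.2 v.2.1 v.2.2) W v.1.1 v.1.2 v.2.1 v.2.2.

Section QuadSums.
Implicit Types (n : nat) (P : nat -> nat -> nat -> nat -> bool).
Implicit Types W : nat -> nat -> nat -> nat -> int.

Lemma eq_qsum n P W W' :
  (forall a x b y, is_quad n a x b y -> P a x b y -> W a x b y = W' a x b y) ->
  qsum n P W = qsum n P W'.
Proof.
move=> e; rewrite /qsum big_seq_cond [RHS]big_seq_cond.
by apply: eq_bigr => v /andP[]; rewrite mem_quads; apply: e.
Qed.

Lemma qsum0 n P W :
  (forall a x b y, is_quad n a x b y -> P a x b y -> W a x b y = 0) -> qsum n P W = 0.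
Proof.
move=> e; rewrite /qsum big_seq_cond big1 // => v /andP[].
by rewrite mem_quads; apply: e.
Qed.

Lemma qsumD n P W W' :
  qsum n P (fun a x b y => W a x b y + W' a x b y) = qsum n P W + qsum n P W'.
Proof. exact: big_split. Qed.

Lemma qsumB n P W W' :
  qsum n P (fun a x b y => W a x b y - W' a x b y) = qsum n P W - qsum n P W'.
Proof. by rewrite /qsum sumrB. Qed.

Lemma qsumZ n P z W : qsum n P (fun a x b y => z * W a x b y) = z * qsum n P W.
Proof. by rewrite /qsum mulr_sumr. Qed.

Lemma qsum_swap n P W :
  qsum n P W = qsum n (fun a x b y => P b y a x) (fun a x b y => W b y a x).
Proof.
rewrite /qsum; pose sw (v : (nat * nat) * (nat * nat)) := (v.2, v.1).
rewrite -(@sum_seq_bij _ _ _ (quads n) (quads n)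
  (fun v => P v.2.1 v.2.2 v.1.1 v.1.2) _ sw sw) ?uniq_quads //.
- by move=> [[a x] [b y]]; rewrite !mem_quads /is_quad /=; split=> //; lia.
- by move=> [[a x] [b y]]; rewrite !mem_quads /is_quad /=; split=> //; lia.
Qed.

(* A Euclidean step on the coefficients [a], [b] of [a x + b y = n]. *)
Lemma qsum_euclid n W :
  qsum n (fun a x b y => x < y)%N (fun a x b y => W (a + b)%N x b (y - x)%N)
  = qsum n (fun a x b y => b < a)%N W.
Proof.
rewrite /qsum.
apply: (@sum_seq_bij _ _ _ _ _ _ _
  (fun v => ((v.1.1 + v.2.1, v.1.2), (v.2.1, v.2.2 - v.1.2)))%N
  (fun v => ((v.1.1 - v.2.1, v.1.2), (v.2.1, v.1.2 + v.2.2)))%N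
  (fun v => W v.1.1 v.1.2 v.2.1 v.2.2)); rewrite ?uniq_quads //.
- move=> [[a x] [b y]]; rewrite !mem_quads /is_quad /= => hq hlt.
  split; [nia|lia|congr (_, _, (_, _)); lia].
- move=> [[a x] [b y]]; rewrite !mem_quads /is_quad /= => hq hlt.
  split; [nia|lia|congr (_, _, (_, _)); lia].
Qed.

Lemma qsum_split n (f g : nat -> nat -> nat -> nat -> nat) W :
  qsum n (fun _ _ _ _ => true) W
  = qsum n (fun a x b y => f a x b y < g a x b y)%N W
    + qsum n (fun a x b y => g a x b y < f a x b y)%N W
    + qsum n (fun a x b y => f a x b y == g a x b y)%N W.
Proof.
rewrite /qsum (bigID (fun v => f v.1.1 v.1.2 v.2.1 v.2.2 == g v.1.1 v.1.2 v.2.1 v.2.2)) /=.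
rewrite addrC; congr (_ + _).
rewrite (bigID (fun v => f v.1.1 v.1.2 v.2.1 v.2.2 < g v.1.1 v.1.2 v.2.1 v.2.2)%N) /=.
by congr (_ + _); apply: eq_bigl => v; case: ltngtP.
Qed.

End QuadSums.

(* Liouville's identity for the function [x ^ 2], weighted by a function of the
   parities of [a], [x], [b], [y]. *)
Section Liouville.
Variables (n : nat) (c : bool -> bool -> bool -> bool -> int).

(** The weight after a Euclidean step: the first summand comes from one of the regions [x < y],
    [b < a], the second from the opposite region once the two products are exchanged. *)
Let k a x b y := c (a (+) b) x b (x (+) y) + c b (x (+) y) (a (+) b) x.
Let C a x b y := c (odd a) (odd x) (odd b) (odd y).
Let K a x b y := k (odd a) (odd x) (odd b) (odd y).
Hypothesis kP : forall a x b y, k a x b y = k a (x (+) y) (a (+) b) y.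

Let sq (a : nat) : int := a%:Z ^+ 2.

Lemma qsum_sum_sq :
  qsum n (fun _ _ _ _ => true) (fun a x b y => C a x b y * sq (a + b))
  = qsum n (fun a x b y => b < a)%N (fun a x b y => K a x b y * sq a)
    + qsum n (fun a x b y => x == y)%N (fun a x b y => C a x b y * sq (a + b)).
Proof.
rewrite (qsum_split n (fun a x b y => x) (fun a x b y => y)); congr (_ + _).
rewrite [X in _ + X]qsum_swap.
rewrite [RHS](eq_qsum (W' := fun a x b y => C (a + b)%N x b (x + y)%N * sq a
                                 + C b (x + y)%N (a + b)%N x * sq a)); last first.
  by move=> a x b y _ _; rewrite /K /C /k !oddD mulrDl.
rewrite qsumD -[X in _ = X + _]qsum_euclid -[X in _ = _ + X]qsum_euclid; congr (_ + _).
  apply: eq_qsum => a x b y _ lt; rewrite /C !oddD (oddB (ltnW lt)).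
  by rewrite -!addbA addbb addbF addbCA addbb addbF.
apply: eq_qsum => a x b y _ lt; rewrite /C !oddD (oddB (ltnW lt)) addnC.
by rewrite -!addbA addbb addbF addbCA addbb addbF.
Qed.

Lemma qsum_diff_sq :
  qsum n (fun _ _ _ _ => true) (fun a x b y => C a x b y * (a%:Z - b%:Z) ^+ 2)
  = qsum n (fun a x b y => x < y)%N (fun a x b y => K a x b y * sq a).
Proof.
rewrite (qsum_split n (fun a x b y => b) (fun a x b y => a)).
rewrite [X in _ + X]qsum0 ?addr0; last first.
  by move=> a x b y _ /eqP->; rewrite subrr expr0n mulr0.
rewrite [X in _ + X]qsum_swap.
rewrite [RHS](eq_qsum (W' := fun a x b y => C (a + b)%N x b (y - x)%N * sq a
                                 + C b (y - x)%N (a + b)%N x * sq a)); last first.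
  by move=> a x b y _ lt; rewrite /K /C /k !oddD (oddB (ltnW lt)) mulrDl (addbC (odd y)).
rewrite qsumD; congr (_ + _).
  rewrite -(qsum_euclid n (fun a x b y => C a x b y * (a%:Z - b%:Z) ^+ 2)).
  by apply: eq_qsum => a x b y _ _; rewrite PoszD addrK.
rewrite -(qsum_euclid n (fun a x b y => C b y a x * (b%:Z - a%:Z) ^+ 2)).
by apply: eq_qsum => a x b y _ _; rewrite PoszD /sq; congr (_ * _); ring.
Qed.

(** The substitution [a x + b y = a (x + y) + (b - a) y] leaves [a] alone, and [kP] says that it
    leaves the weight alone. *)
Lemma qsum_small_coef :
  qsum n (fun a x b y => a < b)%N (fun a x b y => K a x b y * sq a)
  = qsum n (fun a x b y => y < x)%N (fun a x b y => K a x b y * sq a).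
Proof.
rewrite qsum_swap -qsum_euclid qsum_swap; apply: eq_qsum => a x b y _ lt.
by rewrite addnC /K !oddD (oddB (ltnW lt)) -kP.
Qed.

(** Start from [4ab = (a + b)^2 - (a - b)^2]. Up to a diagonal term, the two squares give sums of
    the same function over [b < a] and over [x < y]. The complementary regions [a < b] and [y < x]
    have equal sums, so comparing the two splittings of the full sum leaves only the diagonals. *)
Lemma liouville_sq :
  4 * qsum n (fun _ _ _ _ => true) (fun a x b y => C a x b y * (a%:Z * b%:Z))
  = qsum n (fun a x b y => x == y)%N
      (fun a x b y => C a x b y * sq (a + b) + K a x b y * sq a)
    - qsum n (fun a x b y => a == b)%N (fun a x b y => K a x b y * sq a).
Proof.
rewrite -qsumZ.
rewrite (eq_qsum (W' := fun a x b y => C a x b y * sq (a + b)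
    - C a x b y * (a%:Z - b%:Z) ^+ 2)); last first.
  by move=> a x b y _ _; rewrite /sq PoszD; ring.
rewrite qsumB qsum_sum_sq qsum_diff_sq qsumD.
have e : forall f g, qsum n (fun _ _ _ _ => true) (fun a x b y => K a x b y * sq a) = f ->
  qsum n (fun _ _ _ _ => true) (fun a x b y => K a x b y * sq a) = g -> f = g.
  by move=> f g <- <-.
have := e _ _ (qsum_split n (fun a x b y => b) (fun a x b y => a) _)
          (qsum_split n (fun a x b y => x) (fun a x b y => y) _).
rewrite qsum_small_coef.
have -> : qsum n (fun a x b y => b == a)%N (fun a x b y => K a x b y * sq a)
  = qsum n (fun a x b y => a == b)%N (fun a x b y => K a x b y * sq a).
  by apply: eq_bigl => v; rewrite eq_sym.
by move=> h; lia.
Qed.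

End Liouville.

(** * Convolutions of divisor functions *)

Lemma qsum_diag_x n W :
  qsum n (fun a x b y => x == y)%N W
  = \sum_(p <- pairs n) \sum_(1 <= a < p.1) W a p.2 (p.1 - a)%N p.2.
Proof.
rewrite /qsum -(@sum_seq_dep_bij _ _ _ _ (quads n) (pairs n) (fun p => index_iota 1 p.1)
  (fun v => v.1.2 == v.2.2) predT (fun _ => predT)
  (fun v => (v.1.1 + v.2.1, v.1.2))%N (fun v => v.1.1)
  (fun p a => ((a, p.2), (p.1 - a, p.2)))%N
  (fun p a => W a p.2 (p.1 - a)%N p.2)) ?uniq_quads ?uniq_pairs //.
- by apply: eq_bigr => -[[a x] [b y]] /= /eqP<-; rewrite addKn.
- by move=> y; rewrite iota_uniq.
- move=> [[a x] [b y]]; rewrite mem_quads /is_quad /= mem_pairs mem_index_iota /=.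
  by move=> /and5P[a0 x0 b0 y0 /eqP e] /eqP exy; split=> //; [nia|lia|rewrite exy addKn].
- move=> [d x] a; rewrite mem_pairs mem_index_iota mem_quads /is_quad /=.
  move=> /andP[n0 /eqP e] _ lt _; split => //; first nia.
  by congr (_, _); lia.
Qed.

Lemma qsum_diag_a n W :
  qsum n (fun a x b y => a == b)%N W
  = \sum_(p <- pairs n) \sum_(1 <= x < p.2) W p.1 x p.1 (p.2 - x)%N.
Proof.
rewrite /qsum -(@sum_seq_dep_bij _ _ _ _ (quads n) (pairs n) (fun p => index_iota 1 p.2)
  (fun v => v.1.1 == v.2.1) predT (fun _ => predT)
  (fun v => (v.1.1, v.1.2 + v.2.2))%N (fun v => v.1.2)
  (fun p x => ((p.1, x), (p.1, p.2 - x)))%N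
  (fun p x => W p.1 x p.1 (p.2 - x)%N)) ?uniq_quads ?uniq_pairs //.
- by apply: eq_bigr => -[[a x] [b y]] /= /eqP<-; rewrite addKn.
- by move=> y; rewrite iota_uniq.
- move=> [[a x] [b y]]; rewrite mem_quads /is_quad /= mem_pairs mem_index_iota /=.
  by move=> /and5P[a0 x0 b0 y0 /eqP e] /eqP exy; split=> //; [nia|lia|rewrite exy addKn].
- move=> [d e] x; rewrite mem_pairs mem_index_iota mem_quads /is_quad /=.
  move=> /andP[n0 /eqP h] _ lt _; split => //; first nia.
  by congr (_, _); lia.
Qed.

Lemma conv_pairs n (P Q : pred (nat * nat)) (f g : nat * nat -> int) :
  \sum_(i < n.+1) (\sum_(p <- pairs i | P p) f p) * (\sum_(p <- pairs (n - i) | Q p) g p)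
  = \sum_(v <- quads n | P v.1 && Q v.2) f v.1 * g v.2.
Proof.
rewrite -(big_mkord predT (fun i => (\sum_(p <- pairs i | P p) f p) *
  (\sum_(p <- pairs (n - i) | Q p) g p))).
transitivity (\sum_(i <- index_iota 0 n.+1)
  \sum_(v <- [seq (p, r) | p <- pairs i, r <- pairs (n - i)] | P v.1 && Q v.2) f v.1 * g v.2).
  apply: eq_bigr => i _; rewrite big_distrlr /= [RHS]big_mkcond big_allpairs_dep [LHS]big_mkcond /=.
  apply: eq_bigr => p _; case: (P p) => /=; last by rewrite big1.
  by rewrite big_mkcond.
symmetry; apply: (@sum_seq_dep_bij _ _ _ _ _ _
  (fun i => [seq (p, r) | p <- pairs i, r <- pairs (n - i)]) _ _ (fun _ v => P v.1 && Q v.2)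
  (fun v => v.1.1 * v.1.2)%N (fun v => v) (fun _ v => v) (fun _ v => f v.1 * g v.2)).
- exact: uniq_quads.
- exact: iota_uniq.
- by move=> i; apply: allpairs_uniq; rewrite ?uniq_pairs // => -[? ?] [? ?].
- move=> [[a x] [b y]]; rewrite mem_quads /is_quad /= mem_index_iota => /and5P[a0 x0 b0 y0 /eqP e] PQ.
  split=> //; first lia.
  apply: allpairs_f; rewrite mem_pairs /=; first by rewrite eqxx muln_gt0 a0 x0.
  by rewrite -e addKn eqxx muln_gt0 b0 y0.
- move=> i v; rewrite mem_index_iota => lt _ /allpairsP[[p r] [/= + + ->]] PQ.
  rewrite !mem_pairs => /andP[i0 /eqP ep] /andP[ni0 /eqP er].
  split=> //=; rewrite mem_quads /is_quad /= ep er subnKC ?eqxx; last by lia.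
  by move: i0 ni0; rewrite -er -ep !muln_gt0 => /andP[-> ->] /andP[-> ->].
Qed.

Definition sigma (n : nat) : int := \sum_(p <- pairs n) p.1%:Z.

Definition sigma3_odd (n : nat) : int := \sum_(p <- pairs n | odd p.2) p.1%:Z ^+ 3.

(** The coefficients of the logarithmic derivative [theta psi / psi]. *)
Definition sigma_alt (n : nat) : int := \sum_(p <- pairs n) (-1) ^+ p.1.+1 * p.1%:Z.

Lemma sum_even_odd (n : nat) (F : nat -> int) :
  \sum_(i < n.*2) F i = \sum_(i < n) (F i.*2 + F i.*2.+1).
Proof.
elim: n => [|n IH]; first by rewrite !big_ord0.
by rewrite doubleS !big_ord_recr /= IH addrA.
Qed.

Lemma sum_odd_iota d : \sum_(1 <= a < d.*2) (odd a)%:R = d%:R :> int.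
Proof.
case: d => [|d]; first by rewrite big_geq.
rewrite doubleS; elim: d => [|d IH]; first by rewrite big_nat1.
by rewrite doubleS 2?big_nat_recr //= IH odd_double /= !mulrSr; ring.
Qed.

Lemma odd_sigma n : odd n -> sigma n = \sum_(p <- pairs n | odd p.1 && odd p.2) p.1%:Z.
Proof.
move=> on; rewrite /sigma big_seq_cond [RHS]big_seq_cond; apply: eq_bigl => -[a x] /=.
by rewrite mem_pairs /= andbT; case: eqP => [e|]; rewrite ?andbF // -oddM e on !andbT.

Qed.

Lemma even_sigma0 n : ~~ odd n -> \sum_(p <- pairs n | odd p.1 && odd p.2) p.1%:Z = 0.
Proof.
move=> on; rewrite big_seq_cond big_pred0 // => -[a x] /=.
by rewrite mem_pairs /= -oddM; case: eqP => [->|]; rewrite ?andbF // (negbTE on) andbF.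
Qed.

(** Liouville's identity at [2(n+1)] for the weight selecting odd [a], [x], [b], [y]. The weight [K]
    vanishes on both diagonals, where [a + b] or [x + y] is even. What remains is [(a + b)^2] on
    [x = y]: for [d = a + b] even and [x] odd, each of the [d/2] odd numbers [a < d] gives [d^2], in
    total [4 (d/2)^3]. *)
Lemma sigma_conv n :
  \sum_(i < n.+1) sigma i.*2.+1 * sigma (n - i).*2.+1 = sigma3_odd n.+1.
Proof.
pose o (p : nat * nat) := odd p.1 && odd p.2.
pose s k := \sum_(p <- pairs k | o p) p.1%:Z.
transitivity (\sum_(i < n.+1.*2.+1) s i * s (n.+1.*2 - i)%N).
  have s0 k : s k.*2 = 0 by apply: even_sigma0; rewrite odd_double.
  rewrite [RHS]big_ord_recr /= (s0 n.+1) mul0r addr0.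
  rewrite (sum_even_odd _ (fun i => s i * s (n.+1.*2 - i)%N)); apply: eq_bigr => i _.
  rewrite s0 mul0r add0r /s.
  have -> : (n.+1.*2 - i.*2.+1 = (n - i).*2.+1)%N by have := ltn_ord i; lia.
  by rewrite -!odd_sigma //= odd_double.
transitivity (\sum_(v <- quads n.+1.*2 | o v.1 && o v.2) v.1.1%:Z * v.2.1%:Z).
  exact: (conv_pairs _ o o (fun p => p.1%:Z) (fun p => p.1%:Z)).
pose c (a x b y : bool) : int := [&& a, x, b & y]%:R.
have := @liouville_sq n.+1.*2 c.
rewrite qsum_diag_x qsum_diag_a [X in _ - X]big1; last first.
  move=> p _; rewrite big1 // => x _.
  by rewrite /c addbb /= !andbF !mulr0n addr0 mul0r.
rewrite subr0 => /(_ _)/wrap[|].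
  by rewrite /c => -[] [] [] [].
have -> : qsum n.+1.*2 (fun _ _ _ _ => true)
    (fun a x b y => c (odd a) (odd x) (odd b) (odd y) * (a%:Z * b%:Z))
  = \sum_(v <- quads n.+1.*2 | o v.1 && o v.2) v.1.1%:Z * v.2.1%:Z.
  rewrite /qsum [RHS]big_mkcond; apply: eq_bigr => v _; rewrite /c /o.
  by do 4![case: (odd _)]; rewrite /= ?mul1r ?mul0r.
suff -> : \sum_(p <- pairs n.+1.*2) \sum_(1 <= a < p.1)
   (c (odd a) (odd p.2) (odd (p.1 - a)) (odd p.2) * (a + (p.1 - a))%N%:Z ^+ 2 +
    (c (odd a (+) odd (p.1 - a)) (odd p.2) (odd (p.1 - a)) (odd p.2 (+) odd p.2) +
     c (odd (p.1 - a)) (odd p.2 (+) odd p.2) (odd a (+) odd (p.1 - a)) (odd p.2)) * a%:Z ^+ 2)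
  = 4 * sigma3_odd n.+1.
  by move=> h; lia.
transitivity (\sum_(p <- pairs n.+1.*2 | odd p.2) (p.1%:Z ^+ 2 * \sum_(1 <= a < p.1) (odd a)%:R)).
  rewrite [RHS]big_mkcond big_seq_cond [RHS]big_seq_cond; apply: eq_bigr => -[d x] /=.
  rewrite mem_pairs andbT => /andP[_ /eqP /= e].
  case ox: (odd x); last first.
    by rewrite big1 // => a _; rewrite /c /= !andbF !mul0r addr0.
  have od : odd d = false by move: (congr1 odd e); rewrite oddM ox andbT odd_double.
  rewrite mulr_sumr; apply: eq_big_nat => a /andP[a0 ad].
  rewrite subnKC ?(ltnW ad) // oddB ?(ltnW ad) // od /c /=.
  by case: (odd a); rewrite /=; ring.
rewrite /sigma3_odd mulr_sumr.
rewrite -(@sum_seq_bij _ _ _ (pairs n.+1) (pairs n.+1.*2) (fun p => odd p.2) _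
  (fun p => (p.1.*2, p.2)) (fun p => (p.1./2, p.2))) ?uniq_pairs //.
- by apply: eq_bigr => p _; rewrite /= sum_odd_iota -muln2 PoszM natz; ring.
- move=> [d x] /=; rewrite !mem_pairs /= => /eqP e ox; split => //; first lia.
  by rewrite doubleK.
- move=> [d x] /=; rewrite !mem_pairs /= => /eqP e ox.
  have od : odd d = false by move: (congr1 odd e); rewrite oddM ox andbT odd_double.
  have ed : d./2.*2 = d by have := odd_double_half d; rewrite od.
  by split => //; [lia|rewrite ed].
Qed.

Lemma sum_sq_alt d : odd d ->
  2 * \sum_(1 <= a < d) (-1) ^+ a * a%:Z ^+ 2 = d%:Z * (d%:Z - 1).
Proof.
move=> od; have := odd_double_half d; rewrite od => <-; elim: d./2 => [|k IH].
  by rewrite big_geq.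
rewrite doubleS !addnS 2?big_nat_recr // -addnS !mulrDr IH.
rewrite -[(true + k.*2)%N]/(k.*2.+1) -[(true + k.*2.+1)%N]/(k.*2.+2) !exprS.
have -> : (-1) ^+ k.*2 = 1 :> int by rewrite -signr_odd odd_double.
by rewrite !intS; ring.
Qed.

Lemma sum_even_iota e : odd e -> 2 * \sum_(1 <= x < e) (~~ odd x)%:R = e%:Z - 1 :> int.
Proof.
move=> oe; have := odd_double_half e; rewrite oe => <-; elim: e./2 => [|k IH].
  by rewrite big_geq.
rewrite doubleS !addnS 2?big_nat_recr //= !mulrDr IH odd_double /=.
by lia.
Qed.

Lemma sigma_alt_even_part k :
  \sum_(p <- pairs k.*2 | ~~ odd p.2) (-1) ^+ p.1.+1 * p.1%:Z = sigma_alt k.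
Proof.
rewrite /sigma_alt -(@sum_seq_bij _ _ _ (pairs k) (pairs k.*2) predT (fun p => ~~ odd p.2)
  (fun p => (p.1, p.2.*2)) (fun p => (p.1, p.2./2))) ?uniq_pairs //.
- move=> [d x] /=; rewrite !mem_pairs /= => /andP[k0 /eqP e] _.
  by rewrite odd_double doubleK; split => //; lia.
- move=> [d x] /=; rewrite !mem_pairs /= => /andP[k0 /eqP e] ox.
  have ex : x./2.*2 = x by have := odd_double_half x; rewrite (negbTE ox).
  by rewrite ex; split => //; nia.
Qed.

(** The recurrence of the coefficients of psi^4, verified for [sigma (2n+1)]. In Liouville's
    identity at [2n+1], a factorisation [d x = 2n+1] contributes [d(d-1)/2], an alternating sum of
    squares, from the diagonal [x = y], and [d^2 (x-1)/2] from [a = b]; together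
    [d(dx - 1)/2 = n d]. *)
Lemma sigma_alt_conv n :
  4 * \sum_(i < n.+1) sigma i.*2.+1 * sigma_alt (n - i) = n%:Z * sigma n.*2.+1.
Proof.
pose o (p : nat * nat) := odd p.1 && odd p.2.
pose e (p : nat * nat) := ~~ odd p.2.
pose s k := \sum_(p <- pairs k | o p) p.1%:Z.
pose t k := \sum_(p <- pairs k | e p) (-1) ^+ p.1.+1 * p.1%:Z.
(* [sigma_alt (n - i)] becomes a sum over factorisations of [2(n - i)] with even cofactor, so that
   the two indices add up to [2n+1]. *)
have -> : \sum_(i < n.+1) sigma i.*2.+1 * sigma_alt (n - i)
    = \sum_(i < n.+1.*2) s i * t (n.*2.+1 - i)%N.
  rewrite (sum_even_odd _ (fun i => s i * t (n.*2.+1 - i)%N)); apply: eq_bigr => i _.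
  rewrite [s i.*2]even_sigma0 ?odd_double // mul0r add0r.
  have -> : (n.*2.+1 - i.*2.+1 = (n - i).*2)%N by have := ltn_ord i; lia.
  by rewrite [t _]sigma_alt_even_part odd_sigma //= odd_double.
have -> : \sum_(i < n.+1.*2) s i * t (n.*2.+1 - i)%N
  = \sum_(v <- quads n.*2.+1 | o v.1 && e v.2) v.1.1%:Z * ((-1) ^+ v.2.1.+1 * v.2.1%:Z).
  exact: (conv_pairs n.*2.+1 o e (fun p => p.1%:Z) (fun p => (-1) ^+ p.1.+1 * p.1%:Z)).
pose c (a x b y : bool) : int := [&& a, x & ~~ y]%:R * (if b then 1 else -1).
have := @liouville_sq n.*2.+1 c; rewrite qsum_diag_x qsum_diag_a.
move=> /(_ _)/wrap[|]; first by rewrite /c => -[] [] [] [].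
have -> : qsum n.*2.+1 (fun _ _ _ _ => true)
    (fun a x b y => c (odd a) (odd x) (odd b) (odd y) * (a%:Z * b%:Z))
  = \sum_(v <- quads n.*2.+1 | o v.1 && e v.2) v.1.1%:Z * ((-1) ^+ v.2.1.+1 * v.2.1%:Z).
  rewrite /qsum [RHS]big_mkcond; apply: eq_bigr => v _; rewrite /c /o /e -(signr_odd _ v.2.1.+1).
  by rewrite /=; do 4![case: (odd _)]; rewrite /=; ring.
move=> ->.
have bigE (F G : nat * nat -> int) (H : nat * nat -> int) :
    (forall p, p \in pairs n.*2.+1 -> 2 * F p - 2 * G p = 2 * H p) ->
    \sum_(p <- pairs n.*2.+1) F p - \sum_(p <- pairs n.*2.+1) G p = \sum_(p <- pairs n.*2.+1) H p.
  move=> h; rewrite -sumrB [LHS]big_seq [RHS]big_seq; apply: eq_bigr => p /h; lia.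
rewrite /sigma mulr_sumr; apply: bigE => -[d x]; rewrite mem_pairs /= => /eqP dx.
have od : odd d /\ odd x by move: (congr1 odd dx); rewrite oddM /= odd_double; case: (odd d).
case: od => od ox.
transitivity (2 * (\sum_(1 <= a < d) (-1) ^+ a * a%:Z ^+ 2)
   - 2 * (\sum_(1 <= y < x) - (~~ odd y)%:R * d%:Z ^+ 2)).
  congr (2 * _ - 2 * _); apply: eq_big_nat => a /andP[a0 ad].
    rewrite /c ox /= !andbF !mul0r add0r addr0 oddB ?(ltnW ad) // od -signr_odd.
    by case: (odd a); rewrite /=; ring.
  by rewrite /c oddB ?(ltnW ad) // ox od; case: (odd a); rewrite /=; ring.
rewrite sum_sq_alt // -mulr_suml sumrN mulNr mulrN opprK mulrA sum_even_iota //.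
have dxE : d%:Z * x%:Z = 2 * n%:Z + 1 by rewrite -PoszM dx; lia.
apply/eqP; rewrite -subr_eq0; apply/eqP.
transitivity (d%:Z * (d%:Z * x%:Z - (2 * n%:Z + 1))); first by ring.
by rewrite dxE subrr mulr0.
Qed.

(** * The powers 4 and 8 of psi *)

Lemma leq_triangle k : (k <= triangle k)%N.
Proof. have := double_triangle k; case: k => // k; nia. Qed.

Lemma psi_le M N : (M <= N)%N -> eq_upto M (psi N) (psi M).
Proof.
move=> le; rewrite /psi -!(big_mkord predT (fun k => 'X^(triangle k))).
rewrite (big_cat_nat (n := M)) //= -[X in eq_upto _ _ X]addr0; apply: eq_uptoD => //.
move=> i lt_iM; rewrite coef0 coef_sum big_nat big1 // => k /andP[le_Mk _].
by rewrite coefXn; case: eqP => // e; have := leq_triangle k; lia.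
Qed.

Lemma psi0 N : (psi N.+1)`_0 = 1.
Proof.
rewrite /psi coef_sum big_ord_recl coefXn /= big1 ?addr0 // => k _.
by rewrite coefXn; case: eqP => // e; have := leq_triangle (bump 0 k); rewrite /bump; lia.
Qed.

Lemma prod_odd0 n : (prod_odd n)`_0 = 1.
Proof.
rewrite /prod_odd; elim: n => [|n IH]; first by rewrite big_geq // coef1.
by rewrite big_nat_recr // -['X^_]/('X^(n.*2.+1)) coefM big_ord1 IH coefB coef1 coefXn subr0 mulr1.
Qed.

(** The logarithmic derivative of [1 - q^e] is minus the sum of [e q^(e m)] over [m > 0]. Since
    [e > 0], the terms with [m > N] lie beyond the truncation. *)
Lemma theta_prod N (r : seq nat) (e : nat -> nat) :
  all (fun i => 0 < e i)%N r ->
  eq_upto N (theta (\prod_(i <- r) (1 - 'X^(e i))))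
    (- (\prod_(i <- r) (1 - 'X^(e i))
        * \sum_(i <- r) \sum_(1 <= m < N.+1) (e i)%:Z%:P * 'X^(e i * m))).
Proof.
elim: r => [|i r IH] /=; first by rewrite !big_nil mulr0 /theta derivC mulr0 oppr0.
move=> /andP[ei /IH {}IH]; rewrite !big_cons thetaM.
have geom : eq_upto N (theta (1 - 'X^(e i)))
    (- ((1 - 'X^(e i)) * \sum_(1 <= m < N.+1) (e i)%:Z%:P * 'X^(e i * m))).
  have -> : (1 - 'X^(e i)) * \sum_(1 <= m < N.+1) (e i)%:Z%:P * 'X^(e i * m)
          = (e i)%:Z%:P * ('X^(e i) - 'X^(e i * N.+1)).
    elim: N {IH} => [|N IHN]; first by rewrite big_geq // mulr0 muln1 subrr mulr0.
    rewrite big_nat_recr //= mulrDr IHN.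
    by rewrite (_ : e i * N.+2 = e i + e i * N.+1)%N ?exprD; [ring|lia].
  have -> : theta (1 - 'X^(e i)) = - ((e i)%:Z%:P * ('X^(e i) - 0)) :> {poly int}.
    case: (e i) ei => // k _; rewrite /theta derivB derivC derivXn /= sub0r mulrN mulrnAr -exprS.
    by rewrite subr0 -natz rmorph_nat mulr_natl.
  apply: eq_uptoN; apply: eq_uptoMl; apply: eq_uptoD => //.
  apply: eq_uptoN; apply: eq_upto_sym; apply: eq_upto_Xn0; nia.
apply: eq_upto_trans (eq_uptoD (eq_uptoMr _ geom) (eq_uptoMl _ IH)) _.
by apply: eq_uptoW; ring.
Qed.

(** By Gauss, psi is the quotient of the even factors by the odd ones, so odd divisors enter its
    logarithmic derivative with a plus sign and even ones with a minus sign. The identity is proved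
    after multiplication by [prod_odd n]. *)
Lemma psi_log_deriv n :
  eq_upto n.*2.+1 (theta (psi n.*2.+1)) (psi n.*2.+1 * \poly_(v < n.*2.+1) sigma_alt v).
Proof.
have split_parity M : \sum_(1 <= i < n.+1) \sum_(1 <= m < M) (i.*2.-1)%:Z%:P * 'X^(i.*2.-1 * m)
    - \sum_(1 <= i < n.+1) \sum_(1 <= m < M) (i.*2)%:Z%:P * 'X^(i.*2 * m)
    = \sum_(1 <= i < n.*2.+1) \sum_(1 <= m < M) ((-1) ^+ i.+1 * i%:Z)%:P * 'X^(i * m) :> {poly int}.
  elim: n => [|k IH]; first by rewrite !big_geq // subrr.
  rewrite doubleS !(big_nat_recr k.*2.+2) // !(big_nat_recr k.*2.+1) // -IH.
  rewrite !(big_nat_recr k.+1) //= -[in RHS]signr_odd /= odd_double expr0.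
  rewrite -[in X in _ = _ + X]signr_odd /= odd_double expr1 mul1r mulN1r.
  under [X in _ = _ + X]eq_bigr => m _ do rewrite polyCN mulNr.
  by rewrite sumrN; ring.
set N := n.*2.+1.
pose L (e : nat -> nat) : {poly int} :=
  \sum_(1 <= i < n.+1) \sum_(1 <= m < N.+1) (e i)%:Z%:P * 'X^(e i * m).
have dO : eq_upto N (theta (prod_odd n)) (- (prod_odd n * L (fun i => i.*2.-1))).
  by apply: theta_prod; apply/allP => i; rewrite mem_index_iota; lia.
have dE : eq_upto N (theta (prod_even 0 n)) (- (prod_even 0 n * L double)).
  by apply: theta_prod; apply/allP => i; rewrite mem_index_iota; lia.
have LE : eq_upto N (L (fun i => i.*2.-1) - L double) (\poly_(v < N) sigma_alt v).
  have -> : L (fun i => i.*2.-1) - L double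
    = \sum_(1 <= i < N) \sum_(1 <= m < N.+1) ((-1) ^+ i.+1 * i%:Z)%:P * 'X^(i * m).
    exact: split_parity.
  move=> v lt_vN; rewrite coef_poly lt_vN coef_sum.
  rewrite /sigma_alt.
  rewrite (@sum_seq_dep_bij _ _ _ _ (pairs v) (index_iota 1 N) (fun _ => index_iota 1 N.+1)
    predT predT (fun j m => j * m == v)%N (fun p => p.1) (fun p => p.2) (fun j m => (j, m))
    (fun j _ => (-1) ^+ j.+1 * j%:Z)) ?uniq_pairs ?iota_uniq //.
  - apply: eq_bigr => j _; rewrite coef_sum [RHS]big_mkcond; apply: eq_bigr => m _.
    by rewrite coefCM coefXn eq_sym; case: eqP; rewrite ?mulr1 ?mulr0.
  - move=> [j m] /=; rewrite mem_pairs /= => /andP[v0 /eqP e] _.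
    have /andP[j0 m0] : (0 < j)%N && (0 < m)%N by rewrite -muln_gt0 e.
    have := leq_pmulr j m0; have := leq_pmull m j0; rewrite e => le1 le2.
    by rewrite !mem_index_iota; split => //; lia.
  - move=> j m /=; rewrite mem_pairs /= !mem_index_iota => ? _ ? /eqP e.
    by split => //; rewrite e eqxx andbT -e muln_gt0; lia.
apply: (eq_upto_trans _ (eq_uptoMl _ LE)).
apply: (eq_upto_cancel (prod_odd0 n)).
have := eq_upto_theta (@gauss_psi n); rewrite thetaM => h.
have h1 := eq_upto_trans (eq_upto_sym h) dE.
have h2 := eq_upto_trans h1 (eq_uptoN (eq_uptoMr _ (@gauss_psi n))).
have h3 := eq_uptoD h2 (eq_uptoN (eq_uptoMr (psi N) dO)).
have h4 : eq_upto N (prod_odd n * theta (psi N))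
    (prod_odd n * (psi N * (L (fun i => i.*2.-1) - L double))).
  apply: eq_upto_trans (eq_upto_trans h3 _); apply: eq_uptoW; rewrite /N; ring.
by rewrite ![_ * prod_odd n]mulrC.
Qed.

(** Both sides satisfy [i c_i = 4 sum_(j < i) c_j sigma_alt (i - j)] and start with [c_0 = 1], which
    determines them; the term [j = i] is absent because [sigma_alt 0 = 0]. *)
Lemma psi_pow4 N i : (i < N)%N -> (psi N ^+ 4)`_i = sigma i.*2.+1.
Proof.
(* The logarithmic derivative is available at odd lengths of truncation. *)
move=> lt_iN; set M := N.*2.+1.
have -> : (psi N ^+ 4)`_i = (psi M ^+ 4)`_i.
  have le : (N <= M)%N by lia.
  exact: (eq_uptoX 4 (eq_upto_sym (psi_le le))).
have {lt_iN} : (i < M)%N by lia.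
have D : eq_upto M (theta (psi M ^+ 4)) ((psi M ^+ 4 * \poly_(v < M) sigma_alt v) *+ 4).
  move=> j lt_jM; rewrite theta_exp !coefMn; congr (_ *+ 4); move: j lt_jM.
  apply: eq_upto_trans (eq_uptoMr _ (@psi_log_deriv N)) _.
  by apply: eq_uptoW; rewrite (exprS _ 3) mulrAC.
have alt0 : sigma_alt 0 = 0 by rewrite /sigma_alt big_nil.
elim/ltn_ind: i => -[_ _|i IH lt_iM].
  rewrite !exprS expr0 mulr1 !coef0M !psi0 /sigma.
  by rewrite (_ : pairs _ = [:: (1, 1)%N]) // big_seq1.
have := D _ lt_iM; rewrite coef_theta coefMn [(_ * \poly_(v < M) _ v)`_ _]coefM.
rewrite big_ord_recr /= subnn coef_poly /= alt0 mulr0 addr0.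
have := sigma_alt_conv i.+1; rewrite big_ord_recr /= subnn alt0 mulr0 addr0.
rewrite (eq_bigr (fun j : 'I_i.+1 => (psi M ^+ 4)`_j * (\poly_(v < M) sigma_alt v)`_(i.+1 - j))).
  move=> e1 e2; apply: (@mulfI _ i.+1%:Z) => //; rewrite -e1.
  by rewrite -[i.+1%:Z]natz !mulr_natl e2.
move=> j _; have lt_j := ltn_ord j; rewrite IH ?coef_poly; try lia.
by rewrite (_ : i.+1 - j < M)%N //; lia.
Qed.

Lemma psi_pow8 N i : (i < N)%N -> (psi N ^+ 8)`_i = sigma3_odd i.+1.
Proof.
move=> lt_iN; rewrite (exprD _ 4 4) coefM -sigma_conv; apply: eq_bigr => j _.
by have := ltn_ord j => lt_j; rewrite !psi_pow4 //; lia.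
Qed.

(** Divisors divisible by 11 contribute 0. Those prime to 11 are the same for [m] and [11 m]: the
    factor 11 goes to the cofactor and does not change its parity. *)
Lemma sigma3_odd_mul11 m : (0 < m)%N ->
  (sigma3_odd (11 * m))%:~R = (sigma3_odd m)%:~R :> 'F_11.
Proof.
move=> m0.
have coprime_part k : (sigma3_odd k)%:~R
    = \sum_(p <- pairs k | odd p.2 && ~~ (11 %| p.1)%N) (p.1%:R ^+ 3 : 'F_11).
  rewrite /sigma3_odd rmorph_sum (bigID (fun p => ~~ (11 %| p.1)%N)) /= addrC big1 ?add0r.
    by apply: eq_bigr => p _; rewrite rmorphXn /= pmulrn.
  move=> p /andP[_]; rewrite negbK => /dvdnP[d ->].
  by rewrite rmorphXn /= -pmulrn natrM (_ : 11%:R = 0 :> 'F_11) ?mulr0 ?expr0n //; apply/eqP.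
rewrite !coprime_part; symmetry.
apply: (@sum_seq_bij _ _ _ _ _ _ _ (fun p => (p.1, 11 * p.2)%N) (fun p => (p.1, p.2 %/ 11)%N)
  (fun p => p.1%:R ^+ 3)); rewrite ?uniq_pairs //.
- move=> [d x]; rewrite !mem_pairs /= => /andP[_ /eqP e] /andP[ox nd].
  by rewrite oddM ox nd /= mulKn // muln_gt0 m0; split => //; apply/eqP; lia.
- move=> [d x]; rewrite !mem_pairs /= => /andP[_ /eqP e] /andP[ox nd].
  have /dvdnP[y yE] : (11 %| x)%N.
    rewrite -(@Gauss_dvdr _ d) ?e ?dvdn_mulr //.
    by rewrite prime_coprime.
  move: ox e; rewrite yE mulnK // oddM /= andbT m0 nd => -> e.
  by split => //; [apply/eqP; lia | rewrite mulnC].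
Qed.

(** * The generating function of pod *)

Lemma sum_pred1 (n : nat) (j : 'I_n) (F : 'I_n -> nat) :
  (\sum_i (i == j) * F i = F j)%N.
Proof.
rewrite (bigD1 j) //= eqxx mul1n big1 ?addn0 // => i.
by move/negbTE->.
Qed.

Lemma size_le_sumn (t : seq nat) : all (leq 1) t -> (size t <= sumn t)%N.
Proof. by elim: t => //= x t IH /andP[x0 /IH]; lia. Qed.

Lemma sumn_count_mem n (t : seq nat) : all (fun x => 0 < x <= n)%N t ->
  sumn t = (\sum_(i < n) i.+1 * count_mem i.+1 t)%N.
Proof.
elim: t => /= [_|x t IH /andP[/andP[x0 xn] /IH ->]].
  by rewrite big1 // => i _; rewrite muln0.
case: x x0 xn => // x _ lt_xn.
rewrite [RHS](eq_bigr (fun i : 'I_n => (i == Ordinal lt_xn) * i.+1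
    + i.+1 * count_mem i.+1 t)%N); last first.
  by move=> i _; rewrite mulnDr eqSS -(inj_eq val_inj) /= eq_sym mulnC.
by rewrite [RHS]big_split /= sum_pred1.
Qed.

Section Multiplicities.
Variable n : nat.
Implicit Type f : {ffun 'I_n -> 'I_n.+1}.

Definition seq_of_mult f : seq nat :=
  sort geq (flatten [seq nseq (f i) i.+1 | i <- enum 'I_n]).

Lemma count_seq_of_mult f (i : 'I_n) : count_mem i.+1 (seq_of_mult f) = f i.
Proof.
rewrite /seq_of_mult count_sort count_flatten -map_comp sumnE big_map big_enum /=.
rewrite -(sum_pred1 i (fun i => f i : nat)); apply: eq_bigr => j _.
by rewrite count_nseq /= eqSS.
Qed.

Lemma seq_of_mult_bound f : all (fun x => 0 < x <= n)%N (seq_of_mult f).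
Proof.
apply/allP => x; rewrite mem_sort => /flattenP[u /mapP[i _ ->]].
by rewrite mem_nseq => /andP[_ /eqP->]; exact: ltn_ord.
Qed.

Lemma sumn_seq_of_mult f : sumn (seq_of_mult f) = (\sum_(i < n) i.+1 * f i)%N.
Proof.
rewrite (sumn_count_mem (seq_of_mult_bound f)).
by apply: eq_bigr => i _; rewrite count_seq_of_mult.
Qed.

Lemma eq_count_mem_bound (s t : seq nat) :
  all (fun x => 0 < x <= n)%N s -> all (fun x => 0 < x <= n)%N t ->
  (forall i : 'I_n, count_mem i.+1 s = count_mem i.+1 t) -> perm_eq s t.
Proof.
move=> bs bt e; apply/allP => x; rewrite mem_cat => xst.
have /andP[x0 xn] : (0 < x <= n)%N by case/orP: xst => [/(allP bs)|/(allP bt)].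
by case: x x0 xn {xst} => // x _ xn; apply/eqP; exact: (e (Ordinal xn)).
Qed.

Lemma odd_parts_distinct_count (s : seq nat) (x : nat) :
  odd_parts_distinct s -> odd x -> (count_mem x s <= 1)%N.
Proof.
move=> /(count_uniq_mem x) + ox; rewrite count_filter => e.
rewrite -(eq_count (a1 := predI (pred1 x) odd)) ?e ?leq_b1 // => y /=.
by case: eqP => //= ->.
Qed.

Lemma count_odd_parts_distinct (s : seq nat) :
  (forall x, x \in s -> odd x -> (count_mem x s <= 1)%N) -> odd_parts_distinct s.
Proof.
move=> h; apply: count_mem_uniq => x; rewrite count_filter mem_filter.
case ox: (odd x); last first.
  by apply/eqP; rewrite -leqn0 leqNgt -has_count; apply/hasPn => y _ /=; case: eqP => // ->; rewrite ox.
have -> : count (predI (pred1 x) odd) s = count_mem x s.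
  by apply: eq_count => y /=; case: eqP => //= ->.
have [xs|xs] /= := boolP (x \in s); last by apply/eqP; rewrite -leqn0 leqNgt -has_count has_pred1.
by apply/eqP; rewrite eqn_leq h //= -has_count has_pred1.
Qed.

Lemma seq_of_mult_valid f : (forall i : 'I_n, odd i.+1 -> (f i <= 1)%N) ->
  is_partition (seq_of_mult f) && odd_parts_distinct (seq_of_mult f).
Proof.
move=> hf; apply/andP; split; first (apply/andP; split).
- by apply: sort_sorted => x y; exact: leq_total.
- by apply: sub_all (seq_of_mult_bound f) => x /andP[].
apply: count_odd_parts_distinct => x /(allP (seq_of_mult_bound f)) /andP[x0 xn] ox.
case: x x0 xn ox => // x _ xn ox.
by rewrite (count_seq_of_mult f (Ordinal xn)) hf.
Qed.

Definition mult_of_seq (s : seq nat) : {ffun 'I_n -> 'I_n.+1} :=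
  [ffun i : 'I_n => inord (count_mem i.+1 s)].

Lemma mult_of_seqE s (i : 'I_n) : (size s <= n)%N -> mult_of_seq s i = count_mem i.+1 s :> nat.
Proof. by move=> le; rewrite ffunE inordK // ltnS (leq_trans (count_size _ _)). Qed.

Lemma mult_of_seqK s : (size s <= n)%N -> all (fun x => 0 < x <= n)%N s -> sorted geq s ->
  seq_of_mult (mult_of_seq s) = s.
Proof.
move=> le bs ss; apply: (sorted_eq (leT := geq)) => //.
- by move=> y x z; rewrite /geq => h1 h2; apply: leq_trans h2 h1.
- by move=> x y /andP[]; rewrite /geq; lia.
- by apply: sort_sorted => x y; exact: leq_total.
apply: eq_count_mem_bound => // [|i]; first exact: seq_of_mult_bound.
by rewrite count_seq_of_mult mult_of_seqE.
Qed.

Definition ords_of_seq (s : seq nat) : {bseq n of 'I_n.+1} := insub_bseq n (map inord s).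

Lemma ords_of_seqK s : (size s <= n)%N -> all (fun x => 0 < x <= n)%N s ->
  map val (ords_of_seq s) = s.
Proof.
move=> le bs; rewrite /ords_of_seq /insub_bseq insubdK; last by rewrite unfold_in size_map.
rewrite -map_comp map_id_in // => x /(allP bs) /andP[_ xn].
by rewrite /= inordK.
Qed.

Definition part_series : {poly int} :=
  \sum_(s : {bseq n of 'I_n.+1} | is_partition (map val s) && odd_parts_distinct (map val s))
    'X^(sumn (map val s)).

Definition part_prod : {poly int} :=
  \prod_(i < n) \sum_(m < n.+1 | odd i.+1 ==> (m <= 1)%N) 'X^(i.+1 * m).

(** A partition amounts to its multiplicity function, and expanding the product sums over all such
    functions. Agreement stops at [q^n], because a multiplicity function of larger weight may
    describe more than [n] parts, too many for [{bseq n of 'I_n.+1}]. *)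
Lemma part_seriesE : eq_upto n.+1 part_series part_prod.
Proof.
move=> m lt_m; rewrite /part_series /part_prod bigA_distr_big_dep !coef_sum.
transitivity (\sum_(s : {bseq n of 'I_n.+1} |
   is_partition (map val s) && odd_parts_distinct (map val s) && (sumn (map val s) == m)) 1 : int).
  by rewrite [RHS]big_mkcondr; apply: eq_bigr => s _; rewrite coefXn eq_sym; case: eqP.
transitivity (\sum_(f in family (fun (i : 'I_n) (k : 'I_n.+1) => odd i.+1 ==> (k <= 1)%N)
   | (\sum_(i < n) i.+1 * f i == m)%N) 1 : int); last first.
  by rewrite [LHS]big_mkcondr; apply: eq_bigr => f _; rewrite -expr_sum coefXn eq_sym; case: eqP.
have bound (s : {bseq n of 'I_n.+1}) : is_partition (map val s) ->
    all (fun x => 0 < x <= n)%N (map val s).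
  move=> /andP[_ /allP h]; apply/allP => x xs; rewrite h //=.
  by case/mapP: xs => y _ ->; rewrite -ltnS; exact: ltn_ord.
have sz (s : {bseq n of 'I_n.+1}) : (size (map val s) <= n)%N.
  by rewrite size_map size_bseq.
apply: (@sum_seq_bij _ _ _ _ _ _ _ (fun s : {bseq n of 'I_n.+1} => mult_of_seq (map val s))
  (fun f => ords_of_seq (seq_of_mult f)) (fun _ => 1)); rewrite ?index_enum_uniq //.
- move=> s _ /andP[/andP[ps os] /eqP es]; have bs := bound _ ps; have ss := sz s.
  split; rewrite ?mem_index_enum //.
    apply/andP; split.
      apply/familyP => i; rewrite unfold_in mult_of_seqE //; apply/implyP => oi.
      exact: odd_parts_distinct_count.
    rewrite -es (sumn_count_mem bs); apply/eqP/eq_bigr => i _.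
    by rewrite mult_of_seqE.
  rewrite mult_of_seqK //; last by case/andP: ps.
  apply/val_inj/(inj_map val_inj); exact: ords_of_seqK.
move=> f _ /andP[/familyP hf /eqP ef].
have bf := seq_of_mult_bound f.
have le : (size (seq_of_mult f) <= n)%N.
  apply: leq_trans (size_le_sumn _) _; last by rewrite sumn_seq_of_mult ef -ltnS.
  by apply: sub_all bf => x /andP[].
split; rewrite ?mem_index_enum //.
  rewrite ords_of_seqK // seq_of_mult_valid ?sumn_seq_of_mult ?ef ?eqxx // => i.
  by have := hf i; rewrite unfold_in => /implyP.
rewrite ords_of_seqK //; apply/ffunP => i; apply: val_inj.
by rewrite /= mult_of_seqE // count_seq_of_mult.
Qed.

Lemma part_prodE : eq_upto n.+1
  (part_prod * \prod_(i < n | ~~ odd i.+1) (1 - 'X^(i.+1))) (\prod_(i < n | odd i.+1) (1 + 'X^(i.+1))).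
Proof.
rewrite /part_prod (bigID (fun i : 'I_n => odd i.+1)) /= -mulrA -big_split /=.
rewrite -[X in eq_upto _ _ X]mulr1; apply: eq_uptoM.
  apply: eq_upto_prod => i oi; apply: eq_uptoW.
  have n0 : (0 < n)%N by case: i oi => i /= lt _; lia.
  rewrite (eq_bigl (fun m : 'I_n.+1 => (m <= 1)%N)) => [|m]; last by rewrite oi.
  rewrite -(big_mkord (fun m => (m <= 1)%N) (fun m => 'X^(i.+1 * m))).
  rewrite big_mkcond (big_cat_nat (n := 2)) //= [X in _ + X]big_nat_cond.
  rewrite [X in _ + X]big1 ?addr0; last by move=> j; case: leqP => //; lia.
  by rewrite big_mkcond /= 2?big_ltn // big_geq //= muln0 muln1 addr0 expr0.
apply: (@eq_upto_trans _ _ _ (\prod_(i < n | ~~ odd i.+1) 1)); last first.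
  by apply: eq_uptoW; rewrite big1.
apply: eq_upto_prod => i oi.
rewrite (eq_bigl predT) => [|m]; last by rewrite (negbTE oi).
have geom N : (\sum_(m < N) 'X^(i.+1 * m)) * (1 - 'X^(i.+1)) = 1 - 'X^(i.+1 * N) :> {poly int}.
  elim: N => [|N IH]; first by rewrite big_ord0 muln0 expr0 subrr mul0r.
  by rewrite big_ord_recr /= mulrDl IH mulnS exprD; ring.
rewrite geom -[X in eq_upto _ _ X]subr0; apply: eq_uptoD => //; apply: eq_uptoN.
by apply: eq_upto_Xn0; nia.
Qed.
End Multiplicities.

Definition alt (p : {poly int}) : {poly int} := p \Po (- 'X).

Lemma coef_alt p i : (alt p)`_i = (-1) ^+ i * p`_i.
Proof.
rewrite /alt comp_polyE coef_sum.
under eq_bigr => j _ do rewrite exprNn -(rmorph_sign (@polyC int)) coefZ coefCM coefXn mulrCA.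
have [lt_i|le_i] := ltnP i (size p).
  rewrite (bigD1 (Ordinal lt_i)) //= eqxx mulr1 big1 ?addr0 // => j.
  by rewrite -(inj_eq val_inj) /= eq_sym => /negbTE->; rewrite !mulr0.
rewrite (nth_default 0 le_i) mulr0 big1 // => j _.
by case: eqP => [e|]; rewrite ?mulr0 //; have := ltn_ord j; rewrite -e ltnNge le_i.
Qed.

Lemma eq_upto_alt N p q : eq_upto N p q -> eq_upto N (alt p) (alt q).
Proof. by move=> e i lt; rewrite !coef_alt e. Qed.

Lemma alt_psi0 N : (alt (psi N.+1))`_0 = 1.
Proof. by rewrite coef_alt psi0 mulr1. Qed.

(** Gauss's product at [-q], with its factors indexed by part sizes as in [part_prodE]. *)
Lemma gauss_alt_psi n :
  eq_upto n.*2.+1 (\prod_(i < n.*2 | ~~ odd i.+1) (1 - 'X^(i.+1)))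
    (\prod_(i < n.*2 | odd i.+1) (1 + 'X^(i.+1)) * alt (psi n.*2.+1)).
Proof.
have -> : \prod_(i < n.*2 | ~~ odd i.+1) (1 - 'X^(i.+1)) = alt (prod_even 0 n).
  rewrite /alt /prod_even rmorph_prod /=; elim: n => [|n IH]; first by rewrite big_ord0 big_geq.
  rewrite big_nat_recr //= -IH doubleS big_mkcond !big_ord_recr /= odd_double /= mulr1.
  rewrite -big_mkcond; congr (_ * _).
  by rewrite rmorphB rmorph1 rmorphXn /= comp_polyX exprNn -signr_odd /= odd_double mul1r.
have -> : \prod_(i < n.*2 | odd i.+1) (1 + 'X^(i.+1)) = alt (prod_odd n).
  rewrite /alt /prod_odd rmorph_prod /=; elim: n => [|n IH]; first by rewrite big_ord0 big_geq.
  rewrite big_nat_recr //= -IH doubleS big_mkcond !big_ord_recr /= odd_double /= mulr1.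
  rewrite -big_mkcond; congr (_ * _).
  by rewrite rmorphB rmorph1 rmorphXn /= comp_polyX exprNn -signr_odd /= odd_double expr1 mulN1r opprK.
rewrite /alt -rmorphM; apply: eq_upto_alt; exact: gauss_psi.
Qed.

Lemma eq_upto_prod1D n m (P : pred nat) (c : int) : (n <= m)%N ->
  eq_upto n.+1 (\prod_(i < m | P i) (1 + c *: 'X^(i.+1))) (\prod_(i < n | P i) (1 + c *: 'X^(i.+1))).
Proof.
move=> le; rewrite -!(big_mkord P (fun i => 1 + c *: 'X^(i.+1))).
rewrite (big_cat_nat (n := n)) //= -[X in eq_upto _ _ X]mulr1; apply: eq_uptoM => //.
apply: (@eq_upto_trans _ _ _ (\prod_(n <= i < m | P i) 1)); last by apply: eq_uptoW; rewrite big1.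
rewrite big_nat_cond [X in eq_upto _ _ X]big_nat_cond; apply: eq_upto_prod => i /andP[/andP[le_ni _] _].
rewrite -[X in eq_upto _ _ X]addr0; apply: eq_uptoD => //.
rewrite -(scaler0 _ c) -!mul_polyC; apply: eq_uptoMl; apply: eq_upto_Xn0; lia.
Qed.

Lemma part_series_psi n M : (n < M)%N ->
  eq_upto n.+1 (part_series n * alt (psi M)) 1.
Proof.
move=> lt_nM.
have psiE : eq_upto n.+1 (alt (psi M)) (alt (psi n.*2.+1)).
  apply: eq_upto_alt; apply: eq_upto_trans (psi_le lt_nM) (eq_upto_sym _).
  by apply: psi_le; lia.
have leE : (n <= n.*2)%N by lia.
pose O m : {poly int} := \prod_(i < m | odd i.+1) (1 + 'X^(i.+1)).
pose E m : {poly int} := \prod_(i < m | ~~ odd i.+1) (1 - 'X^(i.+1)).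
have OE : eq_upto n.+1 (O n.*2) (O n).
  have := @eq_upto_prod1D n n.*2 (fun i => odd i.+1) 1 leE.
  by under eq_bigr do rewrite scale1r; under [X in eq_upto _ _ X]eq_bigr do rewrite scale1r.
have EE : eq_upto n.+1 (E n.*2) (E n).
  have := @eq_upto_prod1D n n.*2 (fun i => ~~ odd i.+1) (-1) leE.
  by under eq_bigr do rewrite scaleN1r; under [X in eq_upto _ _ X]eq_bigr do rewrite scaleN1r.
have G : eq_upto n.+1 (E n.*2) (O n.*2 * alt (psi n.*2.+1)).
  by apply: eq_upto_le (@gauss_alt_psi n); lia.
(* Times [O n.*2], the series psi(-q) becomes [E n.*2] by Gauss, and [part_series n] times the even
   factors gives back the odd ones. *)
apply: (eq_upto_cancel (r := O n.*2)).
  rewrite /O; elim/big_rec: _ => [|i p _ IH]; first by rewrite coef1.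
  by rewrite coef0M IH coefD coef1 coefXn addr0 mulr1.
rewrite mul1r -mulrA.
apply: eq_upto_trans (eq_uptoM (@part_seriesE n) (eq_uptoMr _ psiE)) _.
rewrite [alt _ * _]mulrC.
apply: eq_upto_trans (eq_uptoMl _ (eq_upto_sym G)) _.
apply: eq_upto_trans (eq_uptoMl _ EE) _.
exact: eq_upto_trans (@part_prodE n) (eq_upto_sym OE).
Qed.

Lemma pod_neg_coef k n : (pod_neg k n)%:Z = (part_series n ^+ k)`_n.
Proof.
have -> : part_series n ^+ k = \prod_(j < k) part_series n by rewrite prodr_const card_ord.
rewrite /part_series bigA_distr_big coef_sum /pod_neg -sum1_card -natz natr_sum.
rewrite [LHS]big_mkcond [RHS]big_mkcond; apply: eq_bigr => f _; rewrite inE.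
rewrite -expr_sum coefXn eq_sym.
have -> : (f \in ffun_on (fun s : {bseq n of 'I_n.+1} =>
    is_partition (map val s) && odd_parts_distinct (map val s)))
  = [forall j, is_partition (map val (f j)) && odd_parts_distinct (map val (f j))].
  by apply/ffun_onP/forallP => h j; have := h j; rewrite unfold_in.
by case: [forall _, _]; case: eqP.
Qed.

Definition pod_series N : {poly int} := \poly_(n < N) (pod_neg 3 n)%:Z.

Lemma pod_series_psi N : eq_upto N (pod_series N * alt (psi N.+1) ^+ 3) 1.
Proof.
have S_N := @part_series_psi N N.+1 (ltnSn N).
have podE : eq_upto N (pod_series N) (part_series N ^+ 3).
  move=> n lt_nN; rewrite coef_poly lt_nN pod_neg_coef.
  apply: (eq_uptoX (N := n.+1)) => //.
  (* [part_series n] and [part_series N] enumerate different finite types, but both invert psi(-q)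
     up to [q^n] and hence agree there. *)
  apply: (eq_upto_cancel (r := alt (psi N.+1))); first exact: alt_psi0.
  apply: eq_upto_trans (part_series_psi _) (eq_upto_sym (eq_upto_le _ S_N)); lia.
apply: eq_upto_trans (eq_uptoMr _ podE) _.
rewrite -exprMn; apply: eq_upto_trans (eq_uptoX 3 (eq_upto_le (leqnSn N) S_N)) _.
by apply: eq_uptoW; rewrite expr1n.
Qed.

(** * Sums of squares *)

Definition int_interval (M : nat) : seq int :=
  [seq y%:Z - M%:Z | y <- index_iota 0 (M.*2).+1].

Lemma uniq_int_interval M : uniq (int_interval M).
Proof. by rewrite map_inj_uniq ?iota_uniq // => x y /addIr[]. Qed.

Lemma mem_int_interval M x : (x \in int_interval M) = (`|x| <= M)%N.
Proof.
apply/mapP/idP => [[y]|le]; first by rewrite mem_index_iota => ? ->; lia.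
by exists (absz (x + M%:Z)); rewrite ?mem_index_iota; lia.
Qed.

Definition sq_series (P : pred int) (M : nat) : {poly int} :=
  \sum_(x <- int_interval M | P x) 'X^(`|x| ^ 2).

Lemma num_sum_squares_coef k n :
  (num_sum_squares k n)%:Z = (sq_series predT n ^+ k)`_n.
Proof.
have -> : sq_series predT n = \sum_(y < (n.*2).+1) 'X^(`|shifted_int y| ^ 2).
  by rewrite /sq_series big_map big_mkord.
have -> : (\sum_(y < (n.*2).+1) 'X^(`|shifted_int y| ^ 2)) ^+ k
  = \prod_(j < k) \sum_(y < (n.*2).+1) 'X^(`|shifted_int y| ^ 2) :> {poly int}.
  by rewrite prodr_const card_ord.
rewrite bigA_distr_bigA coef_sum /num_sum_squares -sum1_card -natz natr_sum big_mkcond.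
apply: eq_bigr => f _; rewrite inE -expr_sum coefXn.
have -> : (\sum_(i < k) shifted_int (f i) ^+ 2 == n :> int)
        = (n == \sum_(i < k) `|shifted_int (f i)| ^ 2)%N.
  rewrite eq_sym -eqz_nat; congr (_ == _).
  rewrite -natz natr_sum; apply: eq_bigr => i _.
  by rewrite natz; lia.
by case: eqP.
Qed.

Definition odd_int (x : int) : bool := odd `|x|.

(** Because [(2k+1)^2 = 8 triangle k + 1], and each odd square has two roots. *)
Lemma sq_series_odd h : sq_series odd_int h.*2.+1 = (psi h.+1 \Po 'X^8) * 'X *+ 2.
Proof.
rewrite /sq_series (bigID (fun x : int => 0 <= x)) /= mulr2n.
have -> : (psi h.+1 \Po 'X^8) * 'X = \sum_(k <- index_iota 0 h.+1) 'X^(k.*2.+1 ^ 2).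
  rewrite /psi rmorph_sum /= mulr_suml big_mkord.
  apply: eq_bigr => k _; rewrite rmorphXn /= comp_polyX -exprM -exprSr; congr ('X^_).
  by have := double_triangle k; lia.
congr (_ + _).
- rewrite -(@sum_seq_bij _ _ _ (int_interval h.*2.+1) (index_iota 0 h.+1)
    (fun x => odd_int x && (0 <= x)) predT (fun x => `|x|%N./2) (fun k => k.*2.+1%:Z)
    (fun k => 'X^(k.*2.+1 ^ 2))) ?uniq_int_interval ?iota_uniq //.
  + apply: eq_bigr => x /andP[]; rewrite /odd_int => ox _; congr ('X^(_ ^ 2)).
    by have := odd_double_half `|x|; rewrite ox.
  + move=> x; rewrite mem_int_interval mem_index_iota /odd_int => le /andP[ox x0].
    by split => //; lia.
  + move=> k; rewrite mem_int_interval mem_index_iota /odd_int => le _.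
    by split; lia.
- rewrite -(@sum_seq_bij _ _ _ (int_interval h.*2.+1) (index_iota 0 h.+1)
    (fun x => odd_int x && ~~ (0 <= x)) predT (fun x => `|x|%N./2) (fun k => - k.*2.+1%:Z)
    (fun k => 'X^(k.*2.+1 ^ 2))) ?uniq_int_interval ?iota_uniq //.
  + apply: eq_bigr => x /andP[]; rewrite /odd_int => ox _; congr ('X^(_ ^ 2)).
    by have := odd_double_half `|x|; rewrite ox.
  + move=> x; rewrite mem_int_interval mem_index_iota /odd_int => le /andP[ox x0].
    by split => //; lia.
  + move=> k; rewrite mem_int_interval mem_index_iota /odd_int => le _.
    by split; lia.
Qed.

Definition int4 := ((int * int) * (int * int))%type.

Definition norm4 (v : int4) : int := v.1.1 ^+ 2 + v.1.2 ^+ 2 + v.2.1 ^+ 2 + v.2.2 ^+ 2.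

Definition int4s (P : pred int) (M : nat) : seq int4 :=
  let s := filter P (int_interval M) in
  [seq (p, r) | p <- [seq (x, y) | x <- s, y <- s], r <- [seq (x, y) | x <- s, y <- s]].

Lemma uniq_int4s P M : uniq (int4s P M).
Proof.
have us : uniq (filter P (int_interval M)) by rewrite filter_uniq ?uniq_int_interval.
by apply: allpairs_uniq => [||[? ?] [? ?] //]; apply: allpairs_uniq => // -[? ?] [? ?].
Qed.

Lemma mem_int4s P M (v : int4) :
  (v \in int4s P M) = [&& P v.1.1, P v.1.2, P v.2.1 & P v.2.2]
    && [&& `|v.1.1| <= M, `|v.1.2| <= M, `|v.2.1| <= M & `|v.2.2| <= M]%N.
Proof.
have memp (s : seq int) (x y : int) :
    ((x, y) \in [seq (a, b) | a <- s, b <- s]) = (x \in s) && (y \in s).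
  apply/allpairsP/andP => [[[a b] /= [ha hb [-> ->]]]|[hx hy]] //.
  by exists (x, y).
case: v => [[a b] [c d]] /=; rewrite /int4s.
set s := filter _ _; have memf x : (x \in s) = P x && (`|x| <= M)%N.
  by rewrite mem_filter mem_int_interval.
transitivity (((a, b) \in [seq (x, y) | x <- s, y <- s]) && ((c, d) \in [seq (x, y) | x <- s, y <- s])).
  apply/allpairsP/andP => [[[p r] /= [hp hr [-> ->]]]|[hx hy]] //.
  by exists ((a, b), (c, d)).
by rewrite !memp !memf; do 4![case: (P _)]; rewrite ?andbF //=; rewrite !andbA.
Qed.

Lemma coef_sq_series4 P M i :
  (sq_series P M ^+ 4)`_i = \sum_(v <- int4s P M | norm4 v == i%:Z) 1.
Proof.
rewrite /sq_series -big_filter /int4s; set s := filter _ _.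
have pairE (T : Type) (F : T -> nat) (t : seq T) :
    (\sum_(x <- t) 'X^(F x)) * (\sum_(x <- t) 'X^(F x))
    = \sum_(p <- [seq (x, y) | x <- t, y <- t]) 'X^(F p.1 + F p.2) :> {poly int}.
  rewrite big_distrlr big_allpairs_dep; apply: eq_bigr => x _; apply: eq_bigr => y _.
  by rewrite exprD.
rewrite (exprM _ 2 2) !expr2 pairE (pairE _ (fun p => `|p.1| ^ 2 + `|p.2| ^ 2)%N).
rewrite coef_sum [RHS]big_mkcond; apply: eq_bigr => v _; rewrite coefXn.
have -> : (i == `|v.1.1| ^ 2 + `|v.1.2| ^ 2 + (`|v.2.1| ^ 2 + `|v.2.2| ^ 2))%N
   = (norm4 v == i%:Z).
  by rewrite eq_sym -eqz_nat /norm4 -!abszX; congr (_ == _); lia.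
by case: eqP.
Qed.

Definition even_int (x : int) : bool := ~~ odd_int x.

Lemma even_intP x : reflect (exists y, x = 2 * y) (even_int x).
Proof.
rewrite /even_int /odd_int; apply: (iffP idP) => [ex|[y ->]]; last by lia.
by exists (x %/ 2)%Z; lia.
Qed.

Lemma odd_intP x : reflect (exists y, x = 2 * y + 1) (odd_int x).
Proof.
rewrite /odd_int; apply: (iffP idP) => [ex|[y ->]]; last by lia.
by exists (x %/ 2)%Z; lia.
Qed.

Lemma sqr_parity (x : int) : exists k, x ^+ 2 = x + 2 * k.
Proof.
have [/even_intP[y ->]|] := boolP (even_int x); first by exists (2 * y ^+ 2 - y); ring.
rewrite /even_int negbK => /odd_intP[y ->]; exists (2 * y ^+ 2 + y); ring.
Qed.

Lemma abs_le_of_sqr (x : int) (M : nat) : x ^+ 2 <= M%:Z -> (`|x| <= M)%N.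
Proof. by move=> le; nia. Qed.

Lemma norm4_bound v M i : (i <= M)%N -> norm4 v = i%:Z ->
  [&& `|v.1.1| <= M, `|v.1.2| <= M, `|v.2.1| <= M & `|v.2.2| <= M]%N.
Proof.
case: v => [[a b] [c d]]; rewrite /norm4 /= => le e.
have := sqr_ge0 a; have := sqr_ge0 b; have := sqr_ge0 c; have := sqr_ge0 d => d0 c0 b0 a0.
by apply/and4P; split; apply: abs_le_of_sqr; lia.
Qed.

(* Half a Hadamard matrix, a symmetric orthogonal involution. *)
Definition hadamard (v : int4) : int4 :=
  let: ((a, b), (c, d)) := v in
  ((((a + b + c + d) %/ 2)%Z, ((a + b - c - d) %/ 2)%Z),
   (((a - b + c - d) %/ 2)%Z, ((a - b - c + d) %/ 2)%Z)).

Definition sum4 (v : int4) : int := v.1.1 + v.1.2 + v.2.1 + v.2.2.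

(** [hadamard] keeps the norm, and the entries of its image add up to twice the first entry of the
    argument. Hence even quadruples go to sums divisible by 4; conversely this divisibility makes
    the image of an odd quadruple even. *)
Lemma count_even_odd M i : (i <= M)%N -> (i = 4 %[mod 8])%N ->
  \sum_(v <- int4s even_int M | norm4 v == i%:Z) 1
  = \sum_(v <- int4s odd_int M | (norm4 v == i%:Z) && (4 %| sum4 v)%Z) 1 :> int.
Proof.
move=> le i8.
apply: (@sum_seq_bij _ _ _ _ _ _ _ hadamard hadamard (fun _ => 1)); rewrite ?uniq_int4s //.
- move=> [[a b] [c d]] vE /eqP e; rewrite mem_int4s /= in vE.
  case/andP: vE => /and4P[/even_intP[a' ea] /even_intP[b' eb] /even_intP[c' ec] /even_intP[d' ed] _].
  rewrite {}ea {}eb {}ec {}ed {a b c d} in e *.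
  have hE : hadamard ((2 * a', 2 * b'), (2 * c', 2 * d'))
    = ((a' + b' + c' + d', a' + b' - c' - d'), (a' - b' + c' - d', a' - b' - c' + d')).
    by rewrite /hadamard; congr (_, _, (_, _)); lia.
  have nE : norm4 (hadamard ((2 * a', 2 * b'), (2 * c', 2 * d'))) = i%:Z.
    by rewrite hE -e /norm4 /=; ring.
  have := norm4_bound le nE; rewrite mem_int4s nE eqxx hE /= => ->.
  (* As [i] is 4 modulo 8, the sum of squares [i/4] is odd, hence so is [a' + b' + c' + d'], whose
     parity all four entries in [hE] share. *)
  have [ka ea] := sqr_parity a'; have [kb eb] := sqr_parity b'.
  have [kc ec] := sqr_parity c'; have [kd ed] := sqr_parity d'.
  have e4 : 4 * (a' ^+ 2 + b' ^+ 2 + c' ^+ 2 + d' ^+ 2) = i%:Z by rewrite -e /norm4 /=; ring.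
  split; rewrite /odd_int /sum4 /=; [|lia|congr (_, _, (_, _)); lia].
  by rewrite andbT; apply/and4P; split; lia.
- move=> [[a b] [c d]] vO /andP[/eqP e s4]; rewrite mem_int4s /= in vO.
  case/andP: vO => /and4P[/odd_intP[a' ea] /odd_intP[b' eb] /odd_intP[c' ec] /odd_intP[d' ed] _].
  rewrite {}ea {}eb {}ec {}ed {a b c d} in e s4 *.
  (* Here [sum4] is [2 (a' + b' + c' + d') + 4]; eliminating [a'] in favour of [s] displays the four
     images as even. *)
  have {s4} [s es] : exists s, a' + b' + c' + d' = 2 * s.
    by exists ((a' + b' + c' + d') %/ 2)%Z; move: s4; rewrite /sum4 /=; lia.
  have {}es : a' = 2 * s - b' - c' - d' by lia.
  rewrite {}es {a'} in e *; set v := ((_, _), _) in e *.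
  have hE : hadamard v = ((2 * (s + 1), 2 * (s - c' - d')), (2 * (s - b' - d'), 2 * (s - b' - c'))).
    by rewrite /hadamard /v; congr (_, _, (_, _)); lia.
  have nE : norm4 (hadamard v) = i%:Z by rewrite hE -e /norm4 /=; ring.
  have := norm4_bound le nE; rewrite mem_int4s nE eqxx hE /= => ->.
  split; rewrite // ?andbT; last by rewrite /v /hadamard; congr (_, _, (_, _)); lia.
  by apply/and4P; split; apply/even_intP; eexists.
Qed.

(** Negating the odd first entry changes the sum of the four, which is even, by 2 modulo 4. *)
Lemma count_odd_flip M i : (i <= M)%N ->
  \sum_(v <- int4s odd_int M | (norm4 v == i%:Z) && (4 %| sum4 v)%Z) 1
  = \sum_(v <- int4s odd_int M | (norm4 v == i%:Z) && ~~ (4 %| sum4 v)%Z) 1 :> int.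
Proof.
move=> le; pose flip (v : int4) : int4 := ((- v.1.1, v.1.2), v.2).
apply: (@sum_seq_bij _ _ _ _ _ _ _ flip flip (fun _ => 1)); rewrite ?uniq_int4s //.
- move=> [[a b] [c d]]; rewrite !mem_int4s /= => /andP[/and4P[oa ob oc od] bd] /andP[e s4].
  rewrite /flip /norm4 /= sqrrN opprK abszN; split => //.
    by rewrite bd ob oc od {1}/odd_int abszN -[odd _]/(odd_int a) oa.
  by rewrite e; move: oa ob oc od s4; rewrite /odd_int /sum4 /=; lia.
- move=> [[a b] [c d]]; rewrite !mem_int4s /= => /andP[/and4P[oa ob oc od] bd] /andP[e s4].
  rewrite /flip /norm4 /= sqrrN opprK abszN; split => //.
    by rewrite bd ob oc od {1}/odd_int abszN -[odd _]/(odd_int a) oa.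
  by rewrite e; move: oa ob oc od s4; rewrite /odd_int /sum4 /=; lia.
Qed.

Lemma coef_sq_series4_even_odd M i : (i <= M)%N -> (i = 4 %[mod 8])%N ->
  (sq_series odd_int M ^+ 4)`_i = (sq_series even_int M ^+ 4)`_i *+ 2.
Proof.
move=> le i8; rewrite !coef_sq_series4 (bigID (fun v => (4 %| sum4 v)%Z)) /=.
by rewrite -count_odd_flip // -count_even_odd // mulr2n.
Qed.

(** * The congruence *)

Definition exponents_mod (d r : nat) (p : {poly int}) : Prop :=
  forall i, p`_i != 0 -> i = r %[mod d].

Lemma exponents_modM d r s p q : exponents_mod d r p -> exponents_mod d s q ->
  exponents_mod d (r + s) (p * q).
Proof.
move=> hp hq i; apply: contra_neq_eq => ne; rewrite coefM big1 // => j _.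
have [->|/hp pj] := eqVneq p`_j 0; first by rewrite mul0r.
have [->|/hq qj] := eqVneq q`_(i - j) 0; first by rewrite mulr0.
case/eqP: ne; rewrite -modnDm -pj -qj modnDm subnKC //.
by rewrite -ltnS ltn_ord.
Qed.

Lemma exponents_modX d r p k : exponents_mod d r p -> exponents_mod d (r * k) (p ^+ k).
Proof.
move=> hp; elim: k => [|k IH]; last by rewrite exprS mulnS; apply: exponents_modM.
by move=> i; rewrite expr0 coef1 muln0; case: i.
Qed.

Lemma exponents_mod_dvd d e r p : (d %| e)%N -> exponents_mod e r p -> exponents_mod d r p.
Proof. by move=> de hp i /hp h; rewrite -(modn_dvdm i de) h modn_dvdm. Qed.

Lemma exponents_even M : exponents_mod 4 0 (sq_series even_int M).
Proof.
move=> i; apply: contra_neq_eq => ne; rewrite coef_sum big1 // => x /even_intP[y ->].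
rewrite coefXn; case: eqP => // e; case/eqP: ne; rewrite e abszM expnMn.
by rewrite -modnMml (_ : `|2| ^ 2 %% 4 = 0)%N.
Qed.

Lemma exponents_odd M : exponents_mod 8 1 (sq_series odd_int M).
Proof.
move=> i; apply: contra_neq_eq => ne; rewrite coef_sum big1 // => x.
rewrite coefXn; case: eqP => // e ox; case/eqP: ne; rewrite e.
move: ox; rewrite /odd_int => ox; have := odd_double_half `|x|; rewrite ox.
move: (`|x|./2)%N => k <-; have := double_triangle k; lia.
Qed.

(** Even squares are 0 modulo 4 and odd ones 1 modulo 8, so 3 or 7 of the squares are odd. Seven odd
    squares give [2^7 = 128] times the coefficient of psi^7. With three, the even squares add up to
    4 modulo 8, a number that four odd squares represent twice as often as four even ones; so each
    of the 35 placements gives 64 times that coefficient, and [128 + 35 * 64 = 2368]. *)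
Lemma num_sum_7_squares n :
  (num_sum_squares 7 (8 * n + 7))%:Z = 2368 * (psi n.+1 ^+ 7)`_n.
Proof.
rewrite num_sum_squares_coef; set M := (8 * n + 7)%N.
set a := sq_series even_int M; set b := sq_series odd_int M.
have -> : sq_series predT M = a + b by rewrite /sq_series (bigID odd_int) /= addrC.
have M8 : (M = 7 %[mod 8])%N by rewrite /M mulnC modnMDl.
have expb k : exponents_mod 8 k (b ^+ k).
  by rewrite -{1}[k]mul1n; apply/exponents_modX/exponents_odd.
have vanish k : (k <= 7)%N -> (k %% 4 != 3)%N -> (a ^+ (7 - k) * b ^+ k)`_M = 0.
  move=> k7; apply: contraNeq.
  have expa : exponents_mod 4 (0 * (7 - k)) (a ^+ (7 - k)).
    exact/exponents_modX/exponents_even.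
  have expb4 : exponents_mod 4 k (b ^+ k) by apply: exponents_mod_dvd (expb k).
  by move=> /(exponents_modM expa expb4); rewrite mul0n add0n; lia.
have -> : ((a + b) ^+ 7)`_M = 35 * (a ^+ 4 * b ^+ 3)`_M + (b ^+ 7)`_M.
  rewrite exprDn coef_sum !big_ord_recl big_ord0 !coefMn /=.
  rewrite (vanish 0%N) // (vanish 1%N) // (vanish 2%N) // (vanish 4%N) // (vanish 5%N) // (vanish 6%N) //.
  rewrite !mul0rn !add0r addr0 /bump !add1n subnn expr0 mul1r.
  by rewrite mulr_natl.
have half : (b ^+ 7)`_M = 2 * (a ^+ 4 * b ^+ 3)`_M.
  rewrite (exprD b 4 3) !coefM mulr_sumr; apply: eq_bigr => j _.
  have [->|/expb ne] := eqVneq (b ^+ 3)`_(M - j) 0; first by rewrite !mulr0.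
  have lt_j := ltn_ord j; rewrite coef_sq_series4_even_odd ?mulrA ?mulr_natl //; lia.
have bE : (b ^+ 7)`_M = 128 * (psi n.+1 ^+ 7)`_n.
  rewrite /b (_ : M = (4 * n + 3).*2.+1); last by rewrite /M; lia.
  rewrite sq_series_odd exprMn_n exprMn -rmorphXn coefMn coefMXn.
  rewrite ifN; last by lia.
  rewrite coef_comp_poly_Xn // ifT; last by lia.
  rewrite (_ : _ %/ 8 = n)%N; last by lia.
  rewrite mulr_natl; congr (_ *+ _).
  apply: (eq_uptoX (N := n.+1)) => //; apply: psi_le; lia.
by lia.
Qed.

Lemma poly_Fp_exp_p p (pr : prime p) (P : {poly 'F_p}) : P ^+ p = P \Po 'X^p.
Proof.
have pch : p \in [pchar {poly 'F_p}] by rewrite pchar_poly pchar_Fp.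
elim/poly_ind: P => [|P c IH]; first by rewrite comp_poly0 expr0n; case: p pr pch.
rewrite comp_poly_MXaddC -IH -!(pFrobenius_autE pch) rmorphD rmorphM /= !pFrobenius_autE.
by rewrite -rmorphXn /= -[X in c ^+ X](card_Fp pr) expf_card.
Qed.

(** Extracting the exponents congruent to [r] modulo [d]: a factor [P(q^d)] passes through the
    extraction and becomes [P(q)]. *)
Lemma coef_mul_comp_Xn (R : comNzRingType) (A P : {poly R}) d r m :
  (r < d)%N ->
  (A * (P \Po 'X^d))`_(d * m + r) = ((\poly_(j < m.+1) A`_(d * j + r)) * P)`_m.
Proof.
move=> lt_rd; rewrite mulrC (mulrC (\poly_(j < _) _)) !coefM.
rewrite -(big_mkord predT (fun k => (P \Po 'X^d)`_k * A`_(d * m + r - k))).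
rewrite -(big_mkord predT (fun k => P`_k * (\poly_(j < m.+1) A`_(d * j + r))`_(m - k))).
rewrite (bigID (fun k => d %| k)%N) /= [X in _ + X]big1 ?addr0; last first.
  by move=> k nk; rewrite coef_comp_poly_Xn ?(leq_ltn_trans _ lt_rd) // (negbTE nk) mul0r.
rewrite -(@sum_seq_bij _ _ _ (index_iota 0 m.+1) (index_iota 0 (d * m + r).+1)
  predT (fun k => d %| k)%N (fun j => d * j)%N (fun k => k %/ d)%N); rewrite ?iota_uniq //.
- rewrite big_seq_cond [RHS]big_seq_cond; apply: eq_bigr => j /andP[]; rewrite mem_index_iota => lt_j _.
  rewrite coef_comp_poly_Xn ?(leq_ltn_trans _ lt_rd) // dvdn_mulr // mulKn ?(leq_ltn_trans _ lt_rd) //.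
  rewrite coef_poly ltnS leq_subr; congr (_ * A`_ _); nia.
- move=> j; rewrite !mem_index_iota => lt_j _; rewrite dvdn_mulr // mulKn ?(leq_ltn_trans _ lt_rd) //.
  by split => //; nia.
- move=> k; rewrite !mem_index_iota => lt_k dk.
  have e := divnK dk; split => //; last by rewrite mulnC.
  by move: (k %/ d)%N e => q e; nia.
Qed.

Lemma eqz_mod_Fp p (pr : prime p) (x y : int) :
  x%:~R = y%:~R :> 'F_p -> (x = y %[mod p%:Z])%Z.
Proof.
move=> e; apply/eqP; rewrite eqz_mod_dvd (dvdz_pcharf (pchar_Fp pr)).
by rewrite rmorphB /= e subrr.
Qed.

Lemma pod_psi7 n :
  (pod_neg 3 (11 * n + 10))%:~R = (-1) ^+ n * ((psi n.+1 ^+ 7)`_n)%:~R :> 'F_11.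
Proof.
pose N := (11 * n.+1)%N.
pose red := map_poly (intr : int -> 'F_11).
have eq_red M p q : eq_upto M p q -> eq_upto M (red p) (red q).
  by move=> e i lt; rewrite !coef_map_id0 ?e.
pose A := red (pod_series N); pose P := red (alt (psi N.+1)).
have pr11 : prime 11 by [].
have h1 : eq_upto N (A * (P \Po 'X^11)) (P ^+ 8).
  rewrite -(poly_Fp_exp_p pr11) (exprD P 3 8) mulrA -[X in eq_upto _ _ X]mul1r.
  apply: eq_uptoMr; have := eq_red _ _ _ (@pod_series_psi N).
  by rewrite /red rmorphM rmorphXn rmorph1.
have P8 i : (i < N)%N -> (P ^+ 8)`_i = (-1) ^+ i * (sigma3_odd i.+1)%:~R.
  move=> lt; rewrite /P /red -rmorphXn /= coef_map_id0 // /alt -rmorphXn /= -/(alt _) coef_alt.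
  by rewrite psi_pow8 ?rmorphM ?rmorph_sign //; lia.
pose B := \poly_(j < n.+1) A`_(11 * j + 10).
have h2 : eq_upto n.+1 B (P ^+ 7).
  apply: (eq_upto_cancel (r := P)).
    by rewrite /P /red coef_map_id0 // alt_psi0.
  rewrite -exprSr => m lt_m; rewrite P8; last by rewrite /N; lia.
  have := h1 (11 * m + 10)%N; rewrite coef_mul_comp_Xn // P8; last by rewrite /N; lia.
  (* The extracted coefficients of [P ^ 8] are those of [P ^ 8] again: the shift by 1 in
     [sigma3_odd] turns [11m + 10] into [11(m+1)], and [11m + 10] has the parity of [m]. *)
  rewrite (_ : (11 * m + 10).+1 = 11 * m.+1)%N; last by lia.
  rewrite sigma3_odd_mul11 // -signr_odd oddD oddM /= addbF signr_odd.
  move=> <-; last by rewrite /N; lia.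
  rewrite !coefM; apply: eq_bigr => j _; rewrite !coef_poly.
  by have := ltn_ord j => lt_j; rewrite lt_j (leq_trans lt_j lt_m).
have := h2 n (ltnSn n); rewrite coef_poly ltnSn /A /red coef_map_id0 // coef_poly.
rewrite ifT; last by rewrite /N; lia.
move=> ->; rewrite /P -rmorphXn /= coef_map_id0 // /alt -rmorphXn /= -/(alt _) coef_alt.
rewrite rmorphM rmorph_sign; congr (_ * _%:~R).
by apply: (eq_uptoX (N := n.+1)) => //; apply: psi_le; rewrite /N; lia.
Qed.

Theorem theorem4p5 (n : nat) :
  (Posz (pod_neg 3 (11 * n + 10)) =
     4%:Z * (-1) ^+ n * Posz (num_sum_squares 7 (8 * n + 7)) %[mod 11%:Z])%Z.
Proof.
apply: eqz_mod_Fp => //; rewrite pod_psi7 num_sum_7_squares.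
rewrite !rmorphM rmorph_sign /= mulrA [X in _ = X * _](_ : _ = (-1) ^+ n) //.
rewrite mulrAC -rmorphM /= (_ : (4 * 2368)%:~R = 1 :> 'F_11) ?mul1r //.
by apply/eqP.
Qed.
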